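(* Let $\mathbb{K}$ be a field of characteristic zero, let $\sigma\subset\mathbb{R}^n$ be a strongly convex rational cone containing the first orthant ${\mathbb{R}_{\ge0}}^n$, and let $\xi\in\mathbb{K}[[\sigma]]_{x_1\cdots x_n}\setminus\mathbb{K}[[x]]_{x_1\cdots x_n}$ be algebraic over $\mathbb{K}[[x]]$. Then $${\mathbb{R}_{>0}}^n\setminus(\tau_0(\xi)\cup\tau_1(\xi))\neq\emptyset,$$ and for every $\omega\in{\mathbb{R}_{>0}}^n\setminus(\tau_0(\xi)\cup\tau_1(\xi))$ there exists a Laurent polynomial $p\in\mathbb{K}[x]_{x_1\cdots x_n}$ such that the initial part $\operatorname{In}_\omega(\xi+p)$ is defined and $$\#\operatorname{Supp}(\operatorname{In}_\omega(\xi+p))=\infty.$$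
   Context: Cones. A (polyhedral) cone in $\mathbb{R}^n$ is the set of nonnegative real combinations of finitely many vectors; it is rational if the generators can be chosen in $\mathbb{Z}^n$, and strongly convex if it contains no nonzero linear subspace. Series. $x=(x_1,\dots,x_n)$. A Laurent series is a formal sum $\xi=\sum_{\alpha\in\mathbb{Z}^n}\xi_\alpha x^\alpha$, $\xi_\alpha\in\mathbb{K}$, with $\operatorname{Supp}(\xi)=\{\alpha : \xi_\alpha\neq0\}$. For a strongly convex rational cone $\sigma$, $\mathbb{K}[[\sigma]]$ is the ring of Laurent series with support in $\sigma\cap\mathbb{Z}^n$ (Cauchy product). If $\sigma\supset{\mathbb{R}_{\ge0}}^n$, $\mathbb{K}[[\sigma]]_{x_1\cdots x_n}$ is the localization by the powers of $x_1\cdots x_n$, i.e. the ring of Laurent series with support in $\gamma+\sigma$ for some $\gamma\in\mathbb{Z}^n$; $\mathbb{K}[[x]]_{x_1\cdots x_n}$ is the case $\sigma={\mathbb{R}_{\ge0}}^n$, and $\mathbb{K}[x]_{x_1\cdots x_n}$ is the ring of Laurent polynomials. ''Algebraic over $\mathbb{K}[[x]]$'' means: root of a nonzero polynomial with coefficients in $\mathbb{K}[[x]]$. Orders. A preorder on $\mathbb{R}^n$ is a total (any two elements comparable), transitive, translation-invariant relation. For $u_1,\dots,u_s\in\mathbb{R}^n$, $\alpha\leq_{(u_1,\dots,u_s)}\beta$ iff $(\alpha\cdot u_1,\dots,\alpha\cdot u_s)\leq_{\mathrm{lex}}(\beta\cdot u_1,\dots,\beta\cdot u_s)$; preorders of this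 form are continuous, and $\leq_\omega$ is the case $s=1$, $u_1=\omega$. A continuous order is an antisymmetric continuous preorder. $\preceq$ is positive if every element of ${\mathbb{R}_{\ge0}}^n$ is $\succeq0$. $\preceq$ refines $\preceq'$ if $\alpha\preceq\beta$ implies $\alpha\preceq'\beta$. For a continuous positive order $\preceq$, $\mathscr{S}^{\mathbb{K}}_\preceq$ is the field of series $\sum_{\alpha\in\mathbb{Q}^n}\xi_\alpha x^\alpha$ whose support is contained in $(\gamma+\rho)\cap\frac1k\mathbb{Z}^n$ for some $k\in\mathbb{Z}_{>0}$, $\gamma\in\mathbb{Z}^n$ and some rational cone $\rho$ all of whose elements are $\succeq0$. The sets $\tau_0,\tau_1$. Let $P\in\mathbb{K}[[x]][T]$ be the minimal polynomial of $\xi$ and let $\xi_1^\preceq,\xi_2^\preceq,\dots$ be its roots in $\mathscr{S}^{\mathbb{K}}_\preceq$. Then $\tau_0(\xi)$ is the set of $\omega\in{\mathbb{R}_{>0}}^n$ such that for all continuous positive orders $\preceq$ refining $\leq_\omega$ there is $i$ with $\xi=\xi_i^\preceq$; $\tau_1(\xi)$ is the set of $\omega\in{\mathbb{R}_{>0}}^n$ such that for all continuous positive orders $\preceq$ refining $\leq_\omega$ and all $i$, $\xi\neq\xi_i^\preceq$. Initial part. For a nonzero Laurent series $\eta=\sum\eta_\alpha x^\alpha$ such that $\{\alpha\cdot\omega : \alpha\in\operatorname{Supp}(\eta)\}$ has a minimum $\nu_\omega(\eta)$, put $\operatorname{In}_\omega(\eta)=\sum_{\alpha\cdot\omega=\nu_\omega(\eta)}\eta_\alpha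 x^\alpha$. (The minimum exists as soon as $\operatorname{Supp}(\eta)$ is contained in a translate, by an integer vector, of a strongly convex rational cone on which $\omega$ is nonnegative.) *)

(* Defs.v *)
From HB Require Import structures.
From mathcomp Require Import all_boot all_order all_algebra.
From mathcomp Require Import all_classical all_reals.

Set Implicit Arguments.
Unset Strict Implicit.
Unset Printing Implicit Defensive.

Import Order.TTheory GRing.Theory Num.Theory.

Local Open Scope classical_set_scope.
Local Open Scope ring_scope.

Section Geometry.
Context {R : realType} {n : nat}.
Implicit Types (u v : 'rV[R]_n) (sigma : set 'rV[R]_n).

Definition dot u v : R := (u *m v^T) 0 0.

Definition conic_hull (m : nat) (G : 'M[R]_(m, n)) : set 'rV[R]_n :=
  [set v | exists2 c : 'rV[R]_m, (forall i, 0 <= c 0 i) & v = c *m G].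

Definition rational_cone sigma : Prop :=
  exists m (G : 'M[int]_(m, n)), sigma = conic_hull (map_mx intr G).

Definition strongly_convex sigma : Prop :=
  forall V : {vspace 'rV[R]_n}, [set` V] `<=` sigma -> V = 0%VS.

Definition orthant : set 'rV[R]_n := [set v | forall i, 0 <= v 0 i].

Definition pos_orthant : set 'rV[R]_n := [set v | forall i, 0 < v 0 i].

Definition lex_preorder (us : seq 'rV[R]_n) : rel 'rV[R]_n := fun a b =>
  (([seq dot a u | u <- us] : seqlexi R) <= [seq dot b u | u <- us])%O.

Definition omega_preorder (omega : 'rV[R]_n) : rel 'rV[R]_n :=
  lex_preorder [:: omega].

(* Every [lex_preorder us] is total, transitive and translation-invariant. *)
Definition continuous_preorder (le : rel 'rV[R]_n) : Prop :=
  exists us, le = lex_preorder us.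

Definition continuous_order (le : rel 'rV[R]_n) : Prop :=
  continuous_preorder le /\ antisymmetric le.

Definition positive_order (le : rel 'rV[R]_n) : Prop :=
  forall v, orthant v -> le 0 v.

Definition refines (le le' : rel 'rV[R]_n) : Prop :=
  forall a b, le a b -> le' a b.

Lemma omega_preorderE omega a b :
  omega_preorder omega a b = (dot a omega <= dot b omega).
Proof.
rewrite /omega_preorder /lex_preorder /= Order.SeqLexiOrder.Exports.lexi_cons.
by rewrite Order.SeqLexiOrder.Exports.lexi0s implybT andbT.
Qed.

End Geometry.
Arguments orthant : clear implicits.
Arguments pos_orthant : clear implicits.

(* All the rings of series considered live in the single type of formal sums
   with exponents in Q^n; a Laurent series is one supported in Z^n. *)
Definition series (K : Type) (n : nat) : Type := 'rV[rat]_n -> K.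

Section Series.
Context {K : fieldType} {n : nat}.
Implicit Types (f g eta : series K n) (P : seq (series K n)).

Definition Supp f : set 'rV[rat]_n := [set a | f a != 0].

Definition integer_points : set 'rV[rat]_n :=
  [set a | exists b : 'rV[int]_n, a = map_mx intr b].

Definition laurent_polynomial f : Prop :=
  Supp f `<=` integer_points /\ finite_set (Supp f).

Definition zero_series : series K n := fun=> 0.

Definition one_series : series K n := fun a => (a == 0)%:R.

Definition add_series f g : series K n := fun a => f a + g a.

(* The sum has finite support as soon as the supports of [f] and [g] lie in
   (1/k)Z^n and in translates of cones whose sum is strongly convex. *)
Definition cauchy_product f g : series K n :=
  fun c => \sum_(a \in [set: 'rV[rat]_n]) f a * g (c - a).

Definition power f (i : nat) : series K n := iter i (cauchy_product f) one_series.

(* A polynomial in T with coefficients in series is its sequence of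
   coefficients, constant term first. *)
Definition eval_poly P eta : series K n :=
  fun a => \sum_(i < size P)
    cauchy_product (nth zero_series P i) (power eta i) a.

End Series.

Section SeriesOverReals.
Context {K : fieldType} {R : realType} {n : nat}.
Implicit Types (sigma : set 'rV[R]_n) (f xi eta : series K n).
Implicit Types (P Q : seq (series K n)) (omega : 'rV[R]_n).

Definition real_exponent (a : 'rV[rat]_n) : 'rV[R]_n := map_mx ratr a.

Definition cone_series sigma : set (series K n) :=
  [set f | Supp f `<=` integer_points `&` (real_exponent @^-1` sigma)].

Definition cone_series_loc sigma : set (series K n) :=
  [set f | exists gamma : 'rV[int]_n, Supp f `<=` integer_points `&`
    [set a | sigma (real_exponent a - map_mx intr gamma)]].

(* Elements of K[[x]][T] as normalized coefficient sequences: as in {poly _},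
   the last coefficient is nonzero and [::] is the zero polynomial, so that
   the degree in T of a nonzero [P] is [(size P).-1]. *)
Definition power_series_poly P : Prop :=
  (forall i, (i < size P)%N ->
     cone_series (orthant R n) (nth zero_series P i)) /\
  last one_series P <> zero_series.

Definition annihilates P xi : Prop :=
  [/\ power_series_poly P, P <> [::] & eval_poly P xi = zero_series].

Definition algebraic xi : Prop := exists P, annihilates P xi.

(* Two such polynomials are proportional over the fraction field of K[[x]];
   hence they have the same roots in any field extension of it. *)
Definition is_minpoly xi P : Prop :=
  annihilates P xi /\
  forall Q, annihilates Q xi -> (size P <= size Q)%N.

Definition minpoly xi : seq (series K n) := xget [::] [set P | is_minpoly xi P].

Lemma minpolyP xi : algebraic xi -> is_minpoly xi (minpoly xi).
Proof.
move=> [P annP]; apply: (@xgetPex _ [::] [set P | is_minpoly xi P]).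
have exS : exists m, `[< exists2 Q, annihilates Q xi & size Q = m >].
  by exists (size P); apply/asboolP; exists P.
case: (ex_minnP exS) => m /asboolP[Q annQ <-] minQ.
by exists Q; split=> // Q' annQ'; apply: minQ; apply/asboolP; exists Q'.
Qed.

(* The field S_<= of series with support in (gamma + rho) /\ (1/k)Z^n. *)
Definition order_series (le : rel 'rV[R]_n) : set (series K n) :=
  [set f | exists (k : nat) (gamma : 'rV[int]_n) (rho : set 'rV[R]_n),
     [/\ (0 < k)%N, rational_cone rho, (forall v, rho v -> le 0 v) &
         Supp f `<=` [set a | integer_points (k%:R *: a)] `&`
           [set a | rho (real_exponent a - map_mx intr gamma)]]].

Definition order_roots (le : rel 'rV[R]_n) xi : set (series K n) :=
  [set eta | order_series le eta /\ eval_poly (minpoly xi) eta = zero_series].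

Definition tau0 xi : set 'rV[R]_n :=
  [set omega | pos_orthant R n omega /\
    forall le, continuous_order le -> positive_order le ->
      refines le (omega_preorder omega) ->
      exists2 eta, order_roots le xi eta & xi = eta].

Definition tau1 xi : set 'rV[R]_n :=
  [set omega | pos_orthant R n omega /\
    forall le, continuous_order le -> positive_order le ->
      refines le (omega_preorder omega) ->
      forall eta, order_roots le xi eta -> xi <> eta].

Definition weights omega eta : set R :=
  [set dot (real_exponent a) omega | a in Supp eta].

Definition initial_defined omega eta : Prop :=
  exists2 nu, weights omega eta nu & lbound (weights omega eta) nu.

(* Meaningful under [initial_defined omega eta]: the infimum is then the
   minimum nu_omega(eta). *)
Definition initial_part omega eta : series K n :=
  fun a => if dot (real_exponent a) omega == inf (weights omega eta)
           then eta a else 0.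

End SeriesOverReals.
Arguments algebraic {K} R {n} xi.
Arguments tau0 {K} R {n} xi.
Arguments tau1 {K} R {n} xi.

(* Main.v *)
(* Since xi is a root of its minimal polynomial, it is one of the roots in S_<=
   exactly when it belongs to S_<=, i.e. when its support lies in a translate of
   a finitely generated monoid of nonnegative vectors.  The key fact is that, in
   characteristic zero, such series are algebraically closed inside any larger
   ring of series in which algebraic elements have a least exponent: one
   approximates a root u by y so as to lower the degree d of the residue of the
   equation of u - y.  If this residue is a multiple of (T - c)^d, one takes for
   y the Hensel root of the (d-1)-st derivative; the coefficient of degree d - 1
   of the new equation is then zero, so that its residue is no longer a multiple
   of a d-th power.

   Infinite initial part.  Let omega be outside tau0 and tau1.  Since xi lies in
   some S_<=, the levels of omega on Supp xi are discrete.  If all of them were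
   finite, the key fact would put xi in S_<= for every order refining omega.  So
   some level is infinite, and p removes the finitely many terms below the first
   such level.

   Existence of omega.  By Gordan's theorem some omega0 > 0 is positive on sigma.
   Move from omega0 towards a unit vector e_j on which Supp xi is unbounded
   below, up to the first omega at which the weight ceases to control the size of
   the exponents.  Newton's polygon bounds the weights along the way, so omega
   is not e_j.  Orders (omega, +-e_i, ...) show that omega is not in tau0.  For
   the order (omega, omega0, e_1, ..., e_n), the least exponent of an algebraic
   series for omega + t omega0 + ... takes finitely many values as t -> 0, so one
   of them is least for the order, and the key fact puts xi in S_<=; hence omega
   is not in tau1. *)

From HB Require Import structures.
Require Import Defs.
From mathcomp Require Import all_boot all_order all_algebra.
From mathcomp Require Import finmap ring lra.
From mathcomp Require Import all_classical all_reals.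
Set Implicit Arguments.
Unset Strict Implicit.
Unset Printing Implicit Defensive.
Import Order.TTheory GRing.Theory Num.Theory.
Local Open Scope classical_set_scope.
Local Open Scope ring_scope.

(** * Monoids and group orders *)

Section Monoid.
Context {G : zmodType}.
Implicit Types (a b c x : G) (g : seq G) (S T : set G).

(** The submonoid generated by [g], with one multiplicity per generator, so that inductions on [g]
    split off one generator at a time. *)
Fixpoint monoid g : set G :=
  if g is x :: g' then [set a | exists k, monoid g' (a - x *+ k)] else [set 0].

Lemma monoid0 g : monoid g 0.
Proof. by elim: g => //= x g IH; exists 0; rewrite mulr0n subr0. Qed.

Lemma monoidD g a b : monoid g a -> monoid g b -> monoid g (a + b).
Proof.
elim: g a b => [|x g IH] a b /= => [-> ->|[k ka] [l lb]]; first by rewrite addr0.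
by exists (k + l)%N; rewrite mulrnDr opprD addrACA; apply: IH.
Qed.

Lemma monoid_cons x g : monoid g `<=` monoid (x :: g).
Proof. by move=> a ga; exists 0; rewrite mulr0n subr0. Qed.

Lemma monoid_mem g x : x \in g -> monoid g x.
Proof.
elim: g => //= y g IH; rewrite inE => /predU1P[<-|/IH gx].
  by exists 1; rewrite mulr1n subrr; apply: monoid0.
exact: monoid_cons.
Qed.

Lemma monoid_min g S : S 0 -> (forall a b, S a -> S b -> S (a + b)) ->
  (forall x, x \in g -> S x) -> monoid g `<=` S.
Proof.
move=> S0 SD; elim: g => [|x g IH] gS a /=; first by move->.
case=> k /IH Sa; rewrite -(subrK (x *+ k) a); apply: (SD).
  by apply: Sa => y yg; apply: gS; rewrite inE yg orbT.
elim: k {Sa} => [|k IHk]; rewrite ?mulr0n // mulrS.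
by apply: (SD) IHk; apply: gS; rewrite inE eqxx.
Qed.

Lemma monoid_sub g g' : {subset g <= g'} -> monoid g `<=` monoid g'.
Proof.
move=> gg'; apply: monoid_min; [exact: monoid0 | exact: monoidD |].
by move=> x /gg'; apply: monoid_mem.
Qed.

(** Dickson's lemma, for possibly dependent generators. By induction, the projection of [S] along
    the first generator [x] is covered by finitely many points, each of which lifts to [S]. If [K]
    bounds the multiplicities of [x] in these lifts, the elements of multiplicity at least [K] lie
    above the lifts, and the slices of multiplicity less than [K] are covered by induction, one at a
    time. *)
Lemma dickson g a0 S : (forall a, S a -> monoid g (a - a0)) ->
  exists F : seq G, (forall a, a \in F -> S a) /\
    (forall a, S a -> exists2 f, f \in F & monoid g (a - f)).
Proof.
elim: g a0 S => [|x g IH] a0 S Sg.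
  have [S0|nS0] := pselect (S a0).
    exists [:: a0]; split=> a; first by rewrite inE => /eqP->.
    by move=> Sa; exists a0; [rewrite inE | apply: Sg].
  exists [::]; split=> // a Sa; case: nS0.
  by move/Sg: (Sa) => /= /eqP; rewrite subr_eq0 => /eqP<-.
(* The projection of [S] along [x]. *)
pose T := [set m | monoid g (m - a0) /\ exists k, S (m + x *+ k)].
have [|FT [FTS FTb]] := IH a0 T; first by move=> a [].
have [K [F1 [F1S F1b]]] : exists (K : nat) (F1 : seq G), (forall a : G, a \in F1 -> S a) /\
   forall f, f \in FT -> exists2 k, (k <= K)%N & f + x *+ k \in F1.
  elim: FT FTS {FTb} => [|f FT IHF] FTS; first by exists 0%N, [::].
  have [|K [F1 [F1S F1b]]] := IHF.
    by move=> a aF; apply: FTS; rewrite inE aF orbT.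
  have [_ [k Sk]] := FTS f (mem_head _ _).
  exists (maxn k K)%N, (f + x *+ k :: F1); split=> [a|f'].
    by rewrite inE => /predU1P[->//|/F1S].
  rewrite inE => /predU1P[->|/F1b[l lK lF]].
    by exists k; rewrite ?leq_maxl ?mem_head.
  by exists l; [rewrite leq_max lK orbT | rewrite inE lF orbT].
have [F2 [F2S F2b]] : exists F2 : seq G, (forall a : G, a \in F2 -> S a) /\
   forall k a, (k < K)%N -> S a -> monoid g (a - x *+ k - a0) ->
     exists2 f, f \in F2 & monoid g (a - f).
  elim: (K) => [|K' [F2 [F2S F2b]]]; first by exists [::].
  pose SK := [set a | S a /\ monoid g (a - (x *+ K' + a0))].
  have [|F3 [F3S F3b]] := IH (x *+ K' + a0) SK; first by move=> a [].
  exists (F2 ++ F3); split=> [a|k a].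
    by rewrite mem_cat => /orP[/F2S|/F3S[]].
  rewrite ltnS leq_eqVlt => /predU1P[->|kK] Sa ga.
    have [|f fF gf] := F3b a; first by split=> //; rewrite opprD addrA.
    by exists f; rewrite ?mem_cat ?fF ?orbT.
  by have [f fF gf] := F2b k a kK Sa ga; exists f; rewrite ?mem_cat ?fF.
exists (F1 ++ F2); split=> [a|a Sa].
  by rewrite mem_cat => /orP[/F1S|/F2S].
have [k gk] := Sg a Sa.
have [kK|Kk] := ltnP k K.
  have [|f fF gf] := F2b k a kK Sa; first by rewrite addrAC.
  by exists f; rewrite ?mem_cat ?fF ?orbT //; apply: monoid_cons.
have [|f fF gf] := FTb (a - x *+ k).
  by split; [rewrite addrAC | exists k; rewrite subrK].
have [l lK lF] := F1b f fF.
exists (f + x *+ l); first by rewrite mem_cat lF.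
exists (k - l)%N; rewrite mulrnBr ?(leq_trans lK) //.
by rewrite -addrA -opprD -addrA [_ *+ l + _]addrC subrK opprD addrA addrAC.
Qed.

End Monoid.

Section GroupOrder.
Context {G : zmodType}.
Implicit Types (a b c x : G) (g : seq G) (S T nn : set G).

(* A total group order is given by its set [nn] of nonnegative elements. *)
Record group_order nn : Prop := GroupOrder {
  nnD : forall a b, nn a -> nn b -> nn (a + b);
  nn_anti : forall a, nn a -> nn (- a) -> a = 0;
  nn_total : forall a, nn a \/ nn (- a) }.

Definition least nn S a := S a /\ forall b, S b -> nn (b - a).

Definition nonneg nn g := forall x, x \in g -> nn x.

Variables (nn : set G) (go : group_order nn).

Lemma nn0 : nn 0.
Proof. by case: (nn_total go 0) => //; rewrite oppr0. Qed.

Lemma nnMn a k : nn a -> nn (a *+ k).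
Proof.
move=> na; elim: k => [|k IH]; first by rewrite mulr0n; exact: nn0.
by rewrite mulrS; apply: (nnD go).
Qed.

Lemma nn_monoid g : nonneg nn g -> monoid g `<=` nn.
Proof. by move=> gn; apply: monoid_min; [exact: nn0 | exact: (nnD go) |]. Qed.

Lemma nnMn_eq0 a k : nn a -> a *+ k.+1 = 0 -> a = 0.
Proof.
move=> na; rewrite mulrS => /eqP; rewrite addrC addr_eq0 => /eqP ak.
by apply: (nn_anti go) => //; rewrite -ak; apply: nnMn.
Qed.

Lemma mulrIn_group a b k : a *+ k.+1 = b *+ k.+1 -> a = b.
Proof.
move=> /eqP; rewrite -subr_eq0 -mulrnBl => /eqP ab; apply/eqP; rewrite -subr_eq0.
apply/eqP; case: (nn_total go (a - b)) => nab; first exact: nnMn_eq0 ab.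
by apply/eqP; rewrite -oppr_eq0; apply/eqP; apply: (@nnMn_eq0 _ k); rewrite // mulNrn ab oppr0.
Qed.

Lemma nn_cat g g' : nonneg nn g -> nonneg nn g' -> nonneg nn (g ++ g').
Proof. by move=> gn gn' x; rewrite mem_cat => /orP[/gn|/gn']. Qed.

Lemma least_seq (F : seq G) a : a \in F -> exists b, least nn [set` F] b.
Proof.
elim: F a => //= x F IH a _; case: F IH => [|y F] IH.
  exists x; split; rewrite /= ?inE // => b; rewrite /= inE => /eqP->.
  by rewrite subrr; exact: nn0.
have [b [bF bl]] := IH y (mem_head _ _).
case: (nn_total go (b - x)) => bx.
  exists x; split; rewrite /= ?mem_head // => c; rewrite /= inE.
  case/predU1P=> [->|/bl cb]; first by rewrite subrr; exact: nn0.
  by rewrite -(subrK b c) -addrA; apply: (nnD go).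
have bF' : b \in y :: F by exact: bF.
exists b; split; first by rewrite /= in_cons bF' orbT.
move=> c; rewrite /= inE => /predU1P[->|]; last exact: bl.
by rewrite -opprB.
Qed.

Lemma least_finite S : finite_set S -> S !=set0 -> exists b, least nn S b.
Proof.
move=> /finite_seqP[F ->] [a aF]; exact: (@least_seq F a).
Qed.

(** By Dickson's lemma it is enough to compare finitely many elements of [S]. *)
Lemma least_monoid g a0 S : nonneg nn g -> (forall a, S a -> monoid g (a - a0)) ->
  S !=set0 -> exists b, least nn S b.
Proof.
move=> gn Sg [a Sa]; have [F [FS Fb]] := dickson Sg.
have [f0 f0F _] := Fb a Sa; have [b [bF bl]] := least_seq f0F.
exists b; split; first exact: FS.
move=> c /Fb[f fF gf]; rewrite -(subrK f c) -addrA.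
by apply: (nnD go); [apply: nn_monoid gf | apply: bl].
Qed.

(** The translation by [a0] disappears once the finitely many elements of [S] given by Dickson's
    lemma are added to the generators; they are nonnegative because [S] is. *)
Lemma monoid_absorb g a0 S : nonneg nn g -> S `<=` nn ->
  (forall a, S a -> monoid g (a - a0)) ->
  exists g', nonneg nn g' /\ S `<=` monoid g'.
Proof.
move=> gn Sn Sg; have [F [FS Fb]] := dickson Sg.
exists (F ++ g); split; first by apply: nn_cat => // x /FS/Sn.
move=> a /Fb[f fF gf]; rewrite -(subrK f a); apply: monoidD.
  by apply: monoid_sub gf => x xg; rewrite mem_cat xg orbT.
by apply: monoid_mem; rewrite mem_cat fF.
Qed.

End GroupOrder.

(** * Cauchy products and Newton's polygon *)

Section Convolution.
Context {K : fieldType} {G : zmodType}.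
Implicit Types (f g h : G -> K) (a b c : G) (nn : set G).

(** For [G = 'rV[rat]_n], this and the next three definitions are convertible to [Supp],
    [cauchy_product], [one_series] and [power]. *)
Definition supp f : set G := [set a | f a != 0].
Definition conv f g : G -> K := fun c => \sum_(a \in [set: G]) f a * g (c - a).
Definition one : G -> K := fun a => (a == 0)%:R.
Definition pow f i : G -> K := iter i (conv f) one.
Definition shift a f : G -> K := fun c => f (c - a).

Lemma not_supp f a : ~ supp f a -> f a = 0.
Proof. by move/negP; rewrite negbK => /eqP. Qed.

Lemma convE f g c (F : {fset G}) :
  (forall a, f a != 0 -> g (c - a) != 0 -> a \in F) ->
  conv f g c = \sum_(a <- F) f a * g (c - a).
Proof.
move=> fgF; apply: fsbigTE => a /=; apply: contraNeq.
by rewrite mulf_eq0 negb_or => /andP[fa ga]; apply: fgF.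
Qed.

Lemma supp_conv f g : supp (conv f g) `<=` [set c | exists2 a, supp f a & supp g (c - a)].
Proof.
move=> c; apply: contraPP => /= nc; apply/negP; rewrite negbK /conv; apply/eqP.
apply: fsbig1 => a _; apply/eqP; rewrite mulf_eq0.
have [//|fa /=] := eqVneq (f a) 0; have [//|ga] := eqVneq (g (c - a)) 0.
by case: nc; exists a.
Qed.

(** True whatever the supports: a bijective change of index also preserves the default value of an
    infinite sum. *)
Lemma conv_shift a b f g : conv (shift a f) (shift b g) = shift (a + b) (conv f g).
Proof.
apply/funext => c; rewrite /conv /shift.
rewrite (@reindex_fsbigT _ _ _ _ _ (fun x => x + a)).
  by apply: eq_fsbigr => x _; rewrite addrK -!addrA -!opprD -(addrA x) (addrC x).
by exists (fun x => x - a) => x; rewrite ?addrK ?subrK.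
Qed.

Lemma shift_one0 : shift 0 one = one.
Proof. by apply/funext => c; rewrite /shift subr0. Qed.

Lemma pow_shift a f i : pow (shift a f) i = shift (a *+ i) (pow f i).
Proof.
elim: i => [|i IH]; first by rewrite mulr0n shift_one0.
by rewrite /pow /= -!/(pow _ i) IH conv_shift -mulrS.
Qed.

(** Only the pair [(a, b)] contributes to the exponent [a + b], and the product of two nonzero
    coefficients is nonzero. *)
Lemma least_conv nn f g a b : group_order nn -> least nn (supp f) a ->
  least nn (supp g) b -> least nn (supp (conv f g)) (a + b).
Proof.
move=> go [fa la] [gb lb]; split.
  rewrite /supp /= (@convE _ _ _ [fset a]%fset).
    by rewrite big_seq_fset1 [a + b]addrC addrK mulf_neq0.
  move=> x fx gx; rewrite inE.
  have := lb _ gx; rewrite addrAC addrK => nax.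
  rewrite -subr_eq0; apply/eqP/(nn_anti go); first exact: la.
  by rewrite opprB.
move=> c /supp_conv[x fx gx].
have -> : c - (a + b) = (x - a) + (c - x - b).
  by rewrite addrACA -opprD [x + _]addrC subrK.
by apply: (nnD go); [apply: la | apply: lb].
Qed.

Lemma least_one nn : group_order nn -> least nn (supp one) 0.
Proof.
move=> go; split; first by rewrite /supp /= /one eqxx oner_neq0.
move=> b; rewrite /supp /= /one; case: (eqVneq b 0) => [->|]; rewrite ?eqxx //.
by rewrite subr0 => _; exact: nn0 go.
Qed.

Lemma least_pow nn f a i : group_order nn -> least nn (supp f) a ->
  least nn (supp (pow f i)) (a *+ i).
Proof.
move=> go fa; elim: i => [|i IH]; first exact: least_one.
by rewrite mulrS; apply: least_conv.
Qed.

(* Two of the extreme terms of a vanishing sum must have the same exponent. *)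
Lemma newton nn d (b : nat -> G -> K) (u : G -> K) a : group_order nn ->
  least nn (supp u) a ->
  (forall i, (i < d)%N -> supp (b i) !=set0 -> exists c, least nn (supp (b i)) c) ->
  (exists2 i, (i < d)%N & supp (b i) !=set0) ->
  (forall c, \sum_(i < d) conv (b i) (pow u i) c = 0) ->
  exists i j : nat, exists bi bj : G,
   [/\ (i < j < d)%N, least nn (supp (b i)) bi,
       least nn (supp (b j)) bj & bi + a *+ i = bj + a *+ j].
Proof.
move=> go la bl [i0 i0d bi0] sum0.
have key : forall i, exists c, (i < d)%N -> supp (b i) !=set0 -> least nn (supp (b i)) c.
  move=> i; have [[id bi]|nbi] := pselect ((i < d)%N /\ supp (b i) !=set0).
    by have [c ?] := bl i id bi; exists c.
  by exists 0 => id bi; case: nbi.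
have {key}[be beP] := choice key.
pose I := [seq i <- iota 0 d | `[< supp (b i) !=set0 >]].
have memI i : (i \in I) = (i < d)%N && `[< supp (b i) !=set0 >].
  by rewrite mem_filter mem_iota add0n andbC.
have i0I : i0 \in I by rewrite memI i0d; apply/asboolP.
pose e i := be i + a *+ i.
have [m [mI ml]] : exists m, least nn [set` map e I] m.
  by apply: (@least_seq _ _ go _ (e i0)); apply: map_f.
have {mI}/mapP[i iI mE] : m \in map e I by exact: mI.
have el j : j \in I -> least nn (supp (conv (b j) (pow u j))) (e j).
  rewrite memI => /andP[jd /asboolP bj].
  by apply: least_conv => //; [apply: beP | apply: least_pow].
(* If [i] were the only index whose term reaches the least exponent [m], the coefficient of the sum
   at [m] would be that of the term [i], which is nonzero. *)
have [ne|] := pselect (forall j, j \in I -> e j = m -> j = i); last first.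
  move=> /existsNP[j /not_implyP[jI /not_implyP[ej ji]]].
  have [il jl] : least nn (supp (b i)) (be i) /\ least nn (supp (b j)) (be j).
    by move: iI jI; rewrite !memI => /andP[? /asboolP?] /andP[? /asboolP?]; split; apply: beP.
  have [id jd] : (i < d /\ j < d)%N by move: iI jI; rewrite !memI => /andP[-> _] /andP[-> _].
  have eij : e i = e j by rewrite ej -mE.
  case: (ltngtP i j) => [ij|ij|ij].
  - by exists i, j, (be i), (be j); split=> //; rewrite ij.
  - by exists j, i, (be j), (be i); split=> //; rewrite ?ij.
  - by case: ji; rewrite ij.
have id : (i < d)%N by move: iI; rewrite memI => /andP[].
have := sum0 m; rewrite (bigD1 (Ordinal id)) //= big1 ?addr0 => [cm|j ji].
  by have [/negP[]] := el i iI; rewrite -mE cm.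
apply: not_supp => cj.
have jI : (j : nat) \in I.
  rewrite memI ltn_ord; apply/asboolP; have /supp_conv[x bx _] := cj; by exists x.
have em : e j = m.
  apply/eqP; rewrite -subr_eq0; apply/eqP/(nn_anti go).
    by apply: ml; apply: map_f.
  by rewrite opprB; apply: (el j jI).2.
by case/eqP: ji; apply/val_inj/ne.
Qed.

End Convolution.

(** * Rings of series *)

Definition set_add {G : zmodType} (S T : set G) : set G :=
  [set c | exists2 a, S a & T (c - a)].

(* The conditions make the series with support in [fam] a ring under the
   Cauchy product; [sf_weight] serves to iterate contractions. *)
Record support_family (R : realType) (G : zmodType) := SupportFamily {
  nn : set G;
  fam : set (set G);
  sf_order : group_order nn;
  sf_nn : forall S, fam S -> S `<=` nn;
  sf_sub : forall S T, S `<=` T -> fam T -> fam S;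
  sf_setU : forall S T, fam S -> fam T -> fam (S `|` T);
  sf_add : forall S T, fam S -> fam T -> fam (set_add S T);
  sf_fin : forall S T c, fam S -> fam T -> finite_set [set a | S a /\ T (c - a)];
  sf_shift : forall S a, fam S -> (forall b, S b -> nn (b - a)) ->
    fam [set c | S (c + a)];
  sf_monoid : forall g, nonneg nn g -> fam (monoid g);
  sf_weight : forall g, nonneg nn g ->
    exists l : {additive G -> R}, forall x, x \in g -> x != 0 -> 0 < l x
}.

Record ser (K : fieldType) (R : realType) (G : zmodType)
    (F : support_family R G) := Ser {
  ser_val :> G -> K;
  ser_supp : fam F (supp ser_val)
}.

Section SeriesRing.
Context {K : fieldType} {R : realType} {G : zmodType}.
Variable F : support_family R G.
Local Notation T := (ser K F).
Implicit Types f g h : T.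

Lemma ser_inj f g : ser_val f = ser_val g -> f = g.
Proof.
by case: f g => [f Hf] [g Hg] /= E; rewrite E in Hf *; rewrite (Prop_irrelevance Hf Hg).
Qed.

HB.instance Definition _ := gen_eqMixin T.
HB.instance Definition _ := gen_choiceMixin T.

Lemma fam0 : fam F set0.
Proof.
apply: (sf_sub (T := monoid [::])); first exact: sub0set.
by apply: sf_monoid => x; rewrite in_nil.
Qed.

Lemma supp_zero : fam F (supp (fun _ : G => 0 : K)).
Proof. by apply: sf_sub fam0 => a; rewrite /supp /= eqxx. Qed.
Definition ser_zero : T := Ser supp_zero.

Lemma supp_one : fam F (supp (one : G -> K)).
Proof.
have : fam F (monoid [::]) by apply: sf_monoid => x; rewrite in_nil.
apply: sf_sub => a; rewrite /supp /= /one.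
by case: (eqVneq a 0) => //; rewrite eqxx.
Qed.
Definition ser_one : T := Ser supp_one.

Lemma supp_opp f : fam F (supp (fun a => - f a)).
Proof. by apply: sf_sub (ser_supp f) => a; rewrite /supp /= oppr_eq0. Qed.
Definition ser_opp f : T := Ser (supp_opp f).

Lemma supp_add f g : fam F (supp (fun a => f a + g a)).
Proof.
apply: sf_sub (sf_setU (ser_supp f) (ser_supp g)) => a; rewrite /supp /=.
by case: (eqVneq (f a) 0) => [->|]; [rewrite add0r; right | left].
Qed.
Definition ser_add f g : T := Ser (supp_add f g).

Lemma supp_mul f g : fam F (supp (conv f g)).
Proof. exact: sf_sub (@supp_conv _ _ _ _) (sf_add (ser_supp f) (ser_supp g)). Qed.
Definition ser_mul f g : T := Ser (supp_mul f g).

Let addA : associative ser_add.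
Proof. by move=> f g h; apply/ser_inj/funext => a /=; rewrite addrA. Qed.
Let addC : commutative ser_add.
Proof. by move=> f g; apply/ser_inj/funext => a /=; rewrite addrC. Qed.
Let add0 : left_id ser_zero ser_add.
Proof. by move=> f; apply/ser_inj/funext => a /=; rewrite add0r. Qed.
Let addN : left_inverse ser_zero ser_opp ser_add.
Proof. by move=> f; apply/ser_inj/funext => a /=; rewrite addNr. Qed.

HB.instance Definition _ := GRing.isZmodule.Build T addA addC add0 addN.

Let mulC : commutative ser_mul.
Proof.
move=> f g; apply/ser_inj/funext => c /=; rewrite /conv.
rewrite (@reindex_fsbigT _ _ _ _ _ (fun x => c - x)).
  by apply: eq_fsbigr => x _; rewrite subKr mulrC.
by exists (fun x => c - x) => x; rewrite subKr.
Qed.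

Let mulCA : left_commutative ser_mul.
Proof.
move=> h f g; apply/ser_inj/funext => c /=.
have finX (p q : T) : finite_set [set x | supp p x /\ set_add (supp q) (supp g) (c - x)].
  by apply: sf_fin (ser_supp p) (sf_add (ser_supp q) (ser_supp g)).
(* The exponents of [p] that can contribute to the coefficient of [c] in [p q g]. Both triple
   products become sums over the same rectangle, up to the order of summation. *)
pose X (p q : T) := fset_set [set x | supp p x /\ set_add (supp q) (supp g) (c - x)].
have memX (p q : T) x : x \in X p q -> supp p x.
  by rewrite in_fset_set ?inE; [case | exact: finX].
have Xmem (p q : T) x y : p x != 0 -> q y != 0 -> g (c - x - y) != 0 -> x \in X p q.
  by move=> px qy gxy; rewrite in_fset_set ?inE; [split=> //; exists y | exact: finX].
have key (p q : T) : conv p (conv q g) c =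
    \sum_(x <- X p q) \sum_(y <- X q p) p x * (q y * g (c - x - y)).
  rewrite (convE (F := X p q)); last first.
    by move=> x px /supp_conv[y qy gy]; apply: Xmem px qy gy.
  apply: eq_big_seq => x xX; rewrite -mulr_sumr; congr (_ * _).
  apply: convE => y qy gy; apply: Xmem qy (memX _ _ _ xX) _.
  by rewrite addrAC.
rewrite !key exchange_big /=; apply: eq_bigr => x _; apply: eq_bigr => y _.
by rewrite mulrCA addrAC.
Qed.

Let mulA : associative ser_mul.
Proof. by move=> f g h; rewrite (mulC g h) mulCA (mulC h). Qed.

Let mul1 : left_id ser_one ser_mul.
Proof.
move=> f; apply/ser_inj/funext => c /=; rewrite (convE (F := [fset 0]%fset)).
  by rewrite big_seq_fset1 /one eqxx mul1r subr0.
move=> a; rewrite /one inE; case: (eqVneq a 0) => //= _. by rewrite eqxx.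
Qed.

Let mulDl : left_distributive ser_mul ser_add.
Proof.
move=> f g h; rewrite (mulC _ h) (mulC f) (mulC g); apply/ser_inj/funext => c /=.
pose X := fset_set [set x | supp h x /\ (supp f `|` supp g) (c - x)].
have finX := sf_fin c (ser_supp h) (sf_setU (ser_supp f) (ser_supp g)).
have XP x : h x != 0 -> f (c - x) != 0 \/ g (c - x) != 0 -> x \in X.
  by move=> hx fgx; rewrite in_fset_set ?inE.
rewrite !(convE (F := X)) -?big_split /=; last 3 first.
- by move=> x hx gx; apply: XP => //; right.
- by move=> x hx fx; apply: XP => //; left.
- move=> x hx fgx; apply: XP => //; case: (eqVneq (f (c - x)) 0) => [fx|]; last by left.
  by right; move: fgx; rewrite fx add0r.
by apply: eq_bigr => x _; rewrite mulrDr.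
Qed.

Let one_neq0 : ser_one != 0.
Proof.
apply/eqP => /(congr1 (fun f : T => f 0)) /=; rewrite /one eqxx.
exact/eqP/oner_neq0.
Qed.

HB.instance Definition _ := GRing.Zmodule_isComNzRing.Build T mulA mulC mul1 mulDl one_neq0.

Lemma serBE f g a : (f - g) a = f a - g a. Proof. by []. Qed.
Lemma serME f g : (f * g) = conv f g :> (G -> K). Proof. by []. Qed.
Lemma ser1E : (1 : T) = one :> (G -> K). Proof. by []. Qed.
Lemma serXE f i : (f ^+ i) = pow f i :> (G -> K).
Proof.
elim: i => [|i IH]; first by rewrite expr0 ser1E.
by rewrite exprS serME IH.
Qed.

Lemma ser_sumE I (r : seq I) (P : pred I) (E : I -> T) a :
  (\sum_(i <- r | P i) E i) a = \sum_(i <- r | P i) E i a.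
Proof. by elim/big_rec2: _ => // i x y _ <-. Qed.

Lemma ser_eq0 f : (f = 0) <-> supp f = set0.
Proof.
split=> [->|f0]; first by apply/seteqP; split=> // a; rewrite /supp /= eqxx.
apply/ser_inj/funext => a; apply: not_supp; by rewrite f0.
Qed.

Lemma ser_neq0 f : f <> 0 -> supp f !=set0.
Proof. by move=> f0; apply/set0P/eqP => /ser_eq0. Qed.

End SeriesRing.

(** * Residues, monomials and finitely generated supports *)

Section Residue.
Context {K : fieldType} {R : realType} {G : zmodType}.
Variable F : support_family R G.
Local Notation T := (ser K F).
Local Notation nn := (nn F).
Implicit Types (f h : T) (g : seq G) (a b c : G).

Let go : group_order nn := sf_order F.

Lemma ser_nn f a : supp f a -> nn a.
Proof. exact: (sf_nn (ser_supp f)). Qed.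

Definition res f : K := f 0.

Lemma res_additive : zmod_morphism res.
Proof. by []. Qed.

(** All exponents are nonnegative, so [0] is a sum of two of them only as [0 + 0]. *)
Lemma res_mult : monoid_morphism res.
Proof.
split; first by rewrite /res ser1E /one eqxx.
move=> f h; rewrite /res serME (convE (F := [fset 0]%fset)).
  by rewrite big_seq_fset1 subr0.
move=> a fa ha; rewrite inE; apply/eqP/(nn_anti go); first exact: ser_nn fa.
by rewrite -sub0r; apply: ser_nn ha.
Qed.

HB.instance Definition _ := GRing.isZmodMorphism.Build T K res res_additive.
HB.instance Definition _ := GRing.isMonoidMorphism.Build T K res res_mult.

Lemma resB f h : res (f - h) = res f - res h. Proof. by []. Qed.
Lemma resM f h : res (f * h) = res f * res h. Proof. exact: res_mult.2. Qed.

Lemma fam_mono a : nn a -> fam F (supp (shift a (one : G -> K))).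
Proof.
move=> na; apply: (sf_sub (T := monoid [:: a])).
  move=> c; rewrite /supp /= /shift /one subr_eq0.
  case: (eqVneq c a) => [->|]; last by rewrite eqxx.
  by exists 1; rewrite mulr1n subrr.
by apply: sf_monoid => x; rewrite inE => /eqP->.
Qed.

(* [mono a] is the monomial [x^a], and a junk value unless [a] is nonnegative. *)
Definition mono a : T :=
  match pselect (nn a) with
  | left na => Ser (fam_mono na)
  | right _ => 0
  end.

Lemma monoE a : nn a -> mono a = shift a one :> (G -> K).
Proof. by rewrite /mono; case: pselect. Qed.

Lemma mono_mul a f : nn a -> mono a * f = shift a f :> (G -> K).
Proof.
move=> na; rewrite serME monoE // -{1}(_ : shift 0 f = f); last first.
  by apply/funext => c; rewrite /shift subr0.
rewrite conv_shift addr0; congr shift.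
exact: (congr1 (@ser_val _ _ _ _) (mul1r f)).
Qed.

Lemma mono_mulE a f c : nn a -> (mono a * f) c = f (c - a).
Proof. by move=> na; rewrite mono_mul. Qed.

Lemma monoD a b : nn a -> nn b -> mono (a + b) = mono a * mono b.
Proof.
move=> na nb; apply/ser_inj; rewrite mono_mul // !monoE //; last exact: (nnD go).
by apply/funext => c; rewrite /shift opprD addrA addrAC.
Qed.

Lemma mono0 : mono 0 = 1.
Proof. by apply/ser_inj; rewrite monoE ?shift_one0 //; apply: nn0 go. Qed.

Lemma monoX a i : nn a -> mono a ^+ i = mono (a *+ i).
Proof.
move=> na; elim: i => [|i IH]; first by rewrite mulr0n mono0.
by rewrite exprS mulrS monoD ?IH //; apply: nnMn.
Qed.

Lemma mono_inj a f h : nn a -> mono a * f = mono a * h -> f = h.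
Proof.
move=> na E; apply/ser_inj/funext => c.
by have := congr1 (fun p : T => p (c + a)) E; rewrite !mono_mulE // addrK.
Qed.

Lemma mono_div a f : nn a -> (forall c, supp f c -> nn (c - a)) ->
  exists h, f = mono a * h.
Proof.
move=> na fa.
have Hh : fam F (supp (shift (- a) f)).
  apply: sf_sub (sf_shift (ser_supp f) fa) => c.
  by rewrite /supp /shift /= opprK.
exists (Ser Hh); apply/ser_inj; rewrite mono_mul //=.
by apply/funext => c; rewrite /shift opprK subrK.
Qed.

(* Up to a monomial factor, the integral ones are those of the field [S_<=]. *)
Definition fg f := exists g, nonneg nn g /\ supp f `<=` monoid g.

Lemma fg_conv (p q : G -> K) (g g' : seq G) : supp p `<=` monoid g ->
  supp q `<=` monoid g' -> supp (conv p q) `<=` monoid (g ++ g').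
Proof.
move=> pg qg' c /supp_conv[a pa qa]; rewrite -(subrK a c) addrC; apply: monoidD.
  by apply: monoid_sub (pg _ pa) => x xg; rewrite mem_cat xg.
by apply: monoid_sub (qg' _ qa) => x xg; rewrite mem_cat xg orbT.
Qed.

Lemma fg0 : fg 0.
Proof. by exists [::]; split=> // a; rewrite /supp /= eqxx. Qed.

Lemma fg1 : fg 1.
Proof.
exists [::]; split=> // a; rewrite ser1E /supp /= /one.
by case: (eqVneq a 0) => //; rewrite eqxx.
Qed.

Lemma fgD f h : fg f -> fg h -> fg (f + h).
Proof.
move=> [g [gn fg]] [g' [gn' hg']]; exists (g ++ g'); split; first exact: nn_cat.
move=> a; rewrite /supp /=; have [-> /=|fa _] := eqVneq (f a) 0.
  rewrite add0r => ha; apply: monoid_sub (hg' _ ha) => x xg.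
  by rewrite mem_cat xg orbT.
by apply: monoid_sub (fg _ fa) => x xg; rewrite mem_cat xg.
Qed.

Lemma fgN f : fg f -> fg (- f).
Proof.
by move=> [g [gn fg]]; exists g; split=> // a; rewrite /supp /= oppr_eq0; apply: fg.
Qed.

Lemma fgM f h : fg f -> fg h -> fg (f * h).
Proof.
move=> [g [gn fg]] [g' [gn' hg']]; exists (g ++ g'); split; first exact: nn_cat.
by rewrite serME; apply: fg_conv.
Qed.

Lemma fgX f i : fg f -> fg (f ^+ i).
Proof. by move=> ff; elim: i => [|i IH]; [apply: fg1 | rewrite exprS; apply: fgM]. Qed.

Lemma fg_mono a : nn a -> fg (mono a).
Proof.
move=> na; exists [:: a]; split=> [x|c]; first by rewrite inE => /eqP->.
rewrite monoE // /supp /= /shift /one subr_eq0.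
case: (eqVneq c a) => [->|]; last by rewrite eqxx.
by exists 1; rewrite mulr1n subrr.
Qed.

(** Division by the monomial translates the monoid by [- a]; since [f] still has nonnegative
    support, [monoid_absorb] applies. *)
Lemma fg_div a f : nn a -> fg (mono a * f) -> fg f.
Proof.
move=> na [g [gn fg]].
have [||g' [gn' fg']] := @monoid_absorb _ nn g (- a) (supp f) gn.
- by move=> c; apply: ser_nn.
- move=> c fc; rewrite opprK; apply: fg.
  by change ((mono a * f) (c + a) != 0); rewrite mono_mulE ?addrK.
by exists g'.
Qed.

Definition fg_poly (Q : {poly T}) := forall i, fg Q`_i.

Lemma fg_natr f k : fg f -> fg (f *+ k).
Proof. by move=> ff; elim: k => [|k IH]; [apply: fg0 | rewrite mulrS; apply: fgD]. Qed.

Lemma fg_nderivn Q k : fg_poly Q -> fg_poly Q^`N(k).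
Proof. by move=> fQ i; rewrite coef_nderivn; apply: fg_natr. Qed.

Lemma fg_horner Q f : fg_poly Q -> fg f -> fg Q.[f].
Proof.
move=> fQ ff; rewrite horner_coef; elim/big_ind: _ => [|x y|i _].
- exact: fg0.
- exact: fgD.
- by apply: fgM => //; apply: fgX.
Qed.

End Residue.

(** * Hensel roots and algebraic closedness *)

Section Hensel.
Context {K : fieldType} {R : realType} {G : zmodType}.
Variable F : support_family R G.
Local Notation T := (ser K F).
Local Notation nn := (nn F).
Implicit Types (f h u y z : T) (P Q : {poly T}) (g : seq G) (a b c : G).

Let go : group_order nn := sf_order F.

Lemma fg_poly_common P : fg_poly P ->
  exists g, nonneg nn g /\ forall i, supp P`_i `<=` monoid g.
Proof.
move=> fP; have [gs gsP] := choice fP.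
have [g [gn gsg]] : exists g, nonneg nn g /\ forall i, (i < size P)%N -> {subset gs i <= g}.
  elim: (size P) => [|k [g [gn gsg]]]; first by exists [::].
  exists (gs k ++ g); split; first by apply: nn_cat => //; apply: (gsP k).1.
  move=> i; rewrite ltnS leq_eqVlt => /predU1P[->|/gsg ik] x xi.
    by rewrite mem_cat xi.
  by rewrite mem_cat ik ?orbT.
exists g; split=> // i a; have [iP|iP] := ltnP i (size P).
  by move/(gsP i).2; apply: monoid_sub; apply: gsg.
by rewrite nth_default // /supp /= eqxx.
Qed.

Section FixedPoint.
Variables (g : seq G) (l : {additive G -> R}) (dl : R).
Hypotheses (gn : nonneg nn g) (dl_gt0 : 0 < dl)
  (dl_le : forall a, monoid g a -> a <> 0 -> dl <= l a).

(** The filtration used in place of the powers of a maximal ideal: [dl] is a lower bound for the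
    weight of a nonzero exponent. *)
Let V k f := supp f `<=` monoid g `&` [set a | k%:R * dl <= l a].

Let l_ge0 a : monoid g a -> 0 <= l a.
Proof.
have [-> _|/eqP a0 ga] := eqVneq a 0; first by rewrite raddf0.
exact: le_trans (ltW dl_gt0) (dl_le ga a0).
Qed.

Let V_le i j f : (i <= j)%N -> V j f -> V i f.
Proof.
move=> ij Vf a /Vf[ga la]; split=> //=; apply: le_trans la.
by rewrite ler_pM2r // ler_nat.
Qed.

Let V0 k : V k 0.
Proof. by move=> a; rewrite /supp /= eqxx. Qed.

Let VD k f h : V k f -> V k h -> V k (f + h).
Proof.
move=> Vf Vh a; rewrite /supp /=; have [-> /=|fa _] := eqVneq (f a) 0.
  by rewrite add0r; apply: Vh.
exact: Vf.
Qed.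

Let VN k f : V k f -> V k (- f).
Proof. by move=> Vf a; rewrite /supp /= oppr_eq0; apply: Vf. Qed.

Let VM i j f h : V i f -> V j h -> V (i + j)%N (f * h).
Proof.
move=> Vf Vh c; rewrite serME => /supp_conv[a /Vf[ga la] /Vh[hc lc]].
rewrite -(subrK a c) addrC; split; first exact: monoidD.
change ((i + j)%N%:R * dl <= l (a + (c - a))).
by rewrite natrD (raddfD l) mulrDl lerD.
Qed.

Let V_one : V 0 1.
Proof.
move=> a; rewrite ser1E /supp /= /one; case: (eqVneq a 0) => [->|]; last by rewrite eqxx.
by split; [apply: monoid0 | rewrite /= raddf0 mul0r].
Qed.

Let VX f i : V 0 f -> V 0 (f ^+ i).
Proof.
move=> Vf; elim: i => [|i IH]; first exact: V_one.
by rewrite exprS -(addn0 0%N); apply: VM.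
Qed.

Let V_sum k I (r : seq I) (p : pred I) (E : I -> T) :
  (forall i, p i -> V k (E i)) -> V k (\sum_(i <- r | p i) E i).
Proof. by move=> VE; apply: big_ind => [|x y|i pi]; [apply: V0 | apply: VD | apply: VE]. Qed.

Variable P : {poly T}.
Hypotheses (Pg : forall i, supp P`_i `<=` monoid g)
  (Pres : forall i, (0 < i)%N -> res P`_i = 0).

Let VP i : V 0 P`_i.
Proof. by move=> a /Pg ga; split=> //=; rewrite mul0r l_ge0. Qed.

Let VP1 i : (0 < i)%N -> V 1 P`_i.
Proof.
move=> i0 a Pa; split; first exact: Pg Pa.
rewrite /= mul1r; apply: dl_le; first exact: Pg Pa.
by move=> a0; move: Pa; rewrite a0 /supp /= -/(res _) Pres // eqxx.
Qed.

Let V_horner f : V 0 f -> V 0 P.[f].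
Proof.
move=> Vf; rewrite horner_coef; apply: V_sum => i _.
by rewrite -(addn0 0%N); apply: VM; [apply: VP | apply: VX].
Qed.

(** The constant terms cancel. In degree [i > 0], the difference of the powers is a multiple of
    [f - h], and the coefficient has residue [0], which gains one step of the filtration. *)
Let V_contract k f h : V 0 f -> V 0 h -> V k (f - h) -> V k.+1 (P.[f] - P.[h]).
Proof.
move=> Vf Vh Vfh; rewrite !horner_coef -sumrB; apply: V_sum => -[[|i] iP] _ /=.
  by rewrite !expr0 subrr; apply: V0.
rewrite -mulrBr subrXX -addn1 addnC; apply: VM; first exact: VP1.
rewrite -(addn0 k); apply: VM => //; apply: V_sum => j _.
by rewrite -(addn0 0%N); apply: VM; apply: VX.
Qed.

Let zs k := iter k (horner P) 0.

Let V_zs k : V 0 (zs k).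
Proof. by elim: k => [|k IH]; [apply: V0 | apply: V_horner]. Qed.

Let V_zsS k : V k (zs k.+1 - zs k).
Proof.
elim: k => [|k IH]; last exact: (V_contract (@V_zs k.+1) (@V_zs k) IH).
by apply: VD; [apply: V_zs | apply/VN/V_zs].
Qed.

Let V_zs_sub k m : (k <= m)%N -> V k (zs m - zs k).
Proof.
move=> km; rewrite -(subnK km); elim: (m - k)%N => [|d IH].
  by rewrite subrr; apply: V0.
rewrite addSn -(subrK (zs (d + k)%N) (zs _.+1)) -addrA; apply: (VD _ IH).
by apply: (@V_le k (d + k)%N); [rewrite leq_addl | apply: V_zsS].
Qed.

Let V_eq0 k f c : V k f -> l c < k%:R * dl -> f c = 0.
Proof. by move=> Vf lc; apply: not_supp => /Vf[_ /=]; rewrite leNgt lc. Qed.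

(** The iterates of [P] from [0] converge coefficientwise: by contraction, the coefficient at [c] is
    stationary from step [N c] on. The limit is supported in [monoid g], hence belongs to the
    ring. *)
Lemma fixed_point_aux : exists z, supp z `<=` monoid g /\ P.[z] = z.
Proof.
have /choice[N NP] : forall c, exists k : nat, l c < k%:R * dl.
  move=> c; exists (Num.truncn (l c / dl)).+1.
  by rewrite -ltr_pdivrMr // truncnS_gt.
pose z0 c := zs (N c) c.
have z0g : supp z0 `<=` monoid g by move=> c /V_zs[].
pose z : T := Ser (sf_sub z0g (sf_monoid gn)).
have Vz k : V k (z - zs k).
  move=> c cz; have gc : monoid g c.
    have V0z : V 0 z by move=> a /z0g ga; split=> //=; rewrite mul0r l_ge0.
    by have [] := VD V0z (VN (@V_zs k)) cz.
  split=> //=; rewrite leNgt; apply/negP => lc; move/negP: cz; apply.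
  change (zs (N c) c - zs k c == 0); have [kN|/ltnW Nk] := leqP k (N c).
    exact/eqP/(V_eq0 (V_zs_sub kN)).
  by rewrite -opprB oppr_eq0; apply/eqP/(V_eq0 (V_zs_sub Nk)).
have V0z : V 0 z by rewrite -(subr0 z); apply: (Vz 0%N).
exists z; split=> //; apply/ser_inj/funext => c; apply/eqP; rewrite -subr_eq0.
apply/eqP; apply: (@V_eq0 (N c) (P.[z] - z)) => //.
have -> : P.[z] - z = (P.[z] - P.[zs (N c)]) + (zs (N c).+1 - zs (N c)) - (z - zs (N c)).
  by rewrite /zs iterS -!/(zs _) opprB !addrA !subrK.
apply: VD; last exact/VN.
apply: VD; last exact: V_zsS.
exact: (V_le (leqnSn _) (V_contract V0z (@V_zs _) (Vz _))).
Qed.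

End FixedPoint.

(** All coefficients are supported in one monoid, and [sf_weight] gives a weight that is positive on
    its nonzero generators, hence bounded below by some [dl > 0] on its nonzero elements. *)
Lemma fixed_point P : fg_poly P -> (forall i, (0 < i)%N -> res P`_i = 0) ->
  exists z, fg z /\ P.[z] = z.
Proof.
move=> fP Pres; have [g [gn Pg]] := fg_poly_common fP.
have [l lpos] := sf_weight gn.
have [dl [dl0 dlP]] : exists dl : R, 0 < dl /\ forall a, a \in g -> a != 0 -> dl <= l a.
  elim: (g) lpos => [|x s IH] lpos; first by exists 1; rewrite ltr01.
  have [|dl [dl0 dlP]] := IH.
    by move=> y ys; apply: lpos; rewrite inE ys orbT.
  have [x0|x0] := eqVneq x 0.
    exists dl; split=> // a; rewrite inE => /predU1P[->|]; last exact: dlP.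
    by rewrite x0 eqxx.
  exists (Num.min (l x) dl); split; first by rewrite lt_min dl0 lpos ?mem_head.
  move=> a; rewrite inE => /predU1P[->|ays] a0; first by rewrite ge_min lexx.
  by rewrite ge_min dlP ?orbT.
have dlM a : monoid g a -> a = 0 \/ dl <= l a.
  apply: (@monoid_min _ g [set a | a = 0 \/ dl <= l a]); first by left.
    move=> x y /= [->|lx] [->|ly]; rewrite ?addr0 ?add0r; try by [left|right].
    by right; rewrite raddfD -[dl]addr0 lerD // (le_trans (ltW dl0)).
  by move=> x xg /=; have [->|x0] := eqVneq x 0; [left | right; apply: dlP].
have [|z [zg zP]] := @fixed_point_aux g l dl gn dl0 _ P Pg Pres.
  by move=> a /dlM[].
by exists z; split=> //; exists g.
Qed.

Lemma fam_cst k : fam F (supp (fun a : G => k * one a : K)).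
Proof.
apply: sf_sub (@supp_one K R G F) => a; rewrite /supp /=.
by apply: contraNneq => ->; rewrite mulr0.
Qed.
Definition cst k : T := Ser (fam_cst k).

Lemma cst_mulE k f a : (cst k * f) a = k * f a.
Proof.
rewrite serME (convE (F := [fset 0]%fset)).
  by rewrite big_seq_fset1 subr0 /= /one eqxx mulr1.
move=> b /=; rewrite /one inE; case: (eqVneq b 0) => //= _.
by rewrite mulr0 eqxx.
Qed.

Lemma res_cst k : res (cst k) = k.
Proof. by rewrite /res /= /one eqxx mulr1. Qed.

Lemma fg_cst k : fg (cst k).
Proof.
exists [::]; split=> // a; rewrite /supp /= /one; case: (eqVneq a 0) => //= _.
by rewrite mulr0 eqxx.
Qed.

(** The roots of [Q] are the fixed points of [T - Q / k], whose residue is the constant [r];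
    [fixed_point] therefore applies. *)
Lemma hensel Q (k r : K) : fg_poly Q -> k != 0 ->
  map_poly (@res K R G F) Q = k *: ('X - r%:P) ->
  exists y, [/\ fg y, Q.[y] = 0 & res y = r].
Proof.
move=> fQ k0 resQ.
have [||z [fz zP]] := @fixed_point ('X - (cst k^-1)%:P * Q).
- move=> i; rewrite coefB coefX coefCM; apply: fgD.
    by case: (i == 1%N); [apply: fg1 | apply: fg0].
  by apply/fgN/fgM; [apply: fg_cst | apply: fQ].
- move=> i i0; rewrite coefB coefX coefCM.
  rewrite resB resM res_cst.
  have -> : res Q`_i = k * (i == 1%N)%:R.
    rewrite -coef_map resQ coefZ coefB coefX coefC.
    by rewrite (gtn_eqF i0) subr0.
  by rewrite mulKf // [res _](rmorph_nat (@res K R G F)) subrr.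
have Qz : Q.[z] = 0.
  apply/ser_inj/funext => a; move/(congr1 (fun f : T => f a)): zP.
  rewrite hornerD hornerN hornerX hornerCM serBE cst_mulE => /eqP.
  rewrite -subr_eq0 addrAC subrr add0r oppr_eq0 mulf_eq0 invr_eq0 (negPf k0) /=.
  by move/eqP.
exists z; split=> //; apply/eqP; rewrite -subr_eq0.
have := congr1 (horner^~ (res z)) resQ.
rewrite horner_map /= Qz rmorph0 hornerZ hornerXsubC => /esym/eqP.
by rewrite mulf_eq0 (negPf k0).
Qed.

End Hensel.

(** * Newton's algorithm in characteristic zero *)

Section AlgebraicallyClosed.
Context {K : fieldType} {R : realType} {G : zmodType}.
Variable F : support_family R G.
Local Notation T := (ser K F).
Local Notation nn := (nn F).
Local Notation resp := (map_poly (@res K R G F)).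
Implicit Types (f h u y z : T) (P Q : {poly T}) (a b c : G).

Let go : group_order nn := sf_order F.

(** The property asked of the larger ring; it is established below for [germ_family] and
    [locally_fg_family]. *)
Definition algebraic_least := forall Q u, fg_poly Q -> Q <> 0 -> u <> 0 ->
  Q.[u] = 0 -> exists a, least nn (supp u) a.

Hypothesis alg_least : algebraic_least.

(* One step of the Newton algorithm: the root [u - y] of [Q (T + y)] is written
   [x^a u'], and [Q'] is [Q (x^a T + y)] divided by a monomial. *)
Lemma newton_step Q u y m : fg_poly Q -> Q.[u] = 0 -> fg y -> res y = res u ->
  u <> y -> res Q^`N(m).[y] <> 0 ->
  exists Q' u' a, [/\ fg_poly Q', Q'.[u'] = 0, nn a & u = y + mono F a * u'] /\
    [/\ res u' <> 0, exists j, res Q'`_j <> 0, (size (resp Q') <= m.+1)%N &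
        forall j, Q^`N(j).[y] = 0 -> Q'`_j = 0].
Proof.
move=> fQ Qu fy yu uy bm0; pose b j := Q^`N(j).[y].
have fb j : fg (b j) by apply: fg_horner => //; apply: fg_nderivn.
have b_big j : (size Q <= j)%N -> b j = 0.
  by move=> jQ; rewrite /b nderivn_poly0 // horner0.
have mQ : (m < size Q)%N.
  by rewrite ltnNge; apply/negP => /b_big bE; apply: bm0; rewrite -/(b m) bE.
(* The Taylor expansion of [Q] at [y], of which [u - y] is a root. *)
pose P0 := \poly_(j < size Q) b j.
have P0u : P0.[u - y] = 0.
  transitivity Q.[y + (u - y)]; last by rewrite addrC subrK.
  by rewrite horner_poly nderiv_taylor //; apply: mulrC.
have [a [ua la]] : exists a, least nn (supp (u - y)) a.
  apply: (alg_least (Q := P0)) => //.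
  - by move=> i; rewrite coef_poly; case: ifP => _ //; apply: fg0.
  - move=> /(congr1 (fun p : {poly T} => p`_m)); rewrite coef_poly mQ coef0 => bE.
    by apply: bm0; rewrite -/(b m) bE.
  - by move/eqP; rewrite subr_eq0 => /eqP.
have na : nn a by apply: ser_nn ua.
have a0 : a <> 0.
  move=> a0; move: ua; rewrite a0 => /negP; apply; apply/eqP.
  by change (res (u - y) = 0); rewrite resB yu subrr.
have [u' u'E] := mono_div na la.
have nMa k : nn (a *+ k) by apply: nnMn.
pose e j := mono F (a *+ j) * b j.
have fe j : fg (e j) by apply: fgM => //; apply: fg_mono.
have eE j c : e j c = b j (c - a *+ j) by rewrite /e mono_mulE.
pose E := \poly_(j < size Q) e j.
have [g [gn Eg]] : exists g, nonneg nn g /\ forall i, supp E`_i `<=` monoid g.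
  apply: fg_poly_common => i; rewrite coef_poly; case: ifP => _; first exact: fe.
  exact: fg0.
pose S := [set c | exists2 j, (j < size Q)%N & supp (e j) c].
have Sam : S (a *+ m).
  exists m => //; change (e m (a *+ m) != 0); rewrite eE subrr; exact/eqP.
(* [mu] is the least exponent occurring in the coefficients of [P0 (x^a T)]. Dividing by [x^mu]
   makes some residue nonzero. *)
have [mu [[j0 j0Q emu] lmu]] : exists mu, least nn S mu.
  apply: (least_monoid go (a0 := 0) gn); last by exists (a *+ m).
  by move=> c [j jQ ec]; rewrite subr0; apply: (Eg j); rewrite coef_poly jQ.
have nmu : nn mu := ser_nn emu.
have /choice[q qE] : forall j, exists q, (j < size Q)%N -> e j = mono F mu * q.
  move=> j; have [jQ|] := boolP (j < size Q)%N; last by exists 0.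
  have [|q ->] := @mono_div K R G F mu (e j) nmu; last by exists q.
  by move=> c ec; apply: lmu; exists j.
pose Q' := \poly_(j < size Q) q j.
have resq j : (j < size Q)%N -> res (q j) = e j mu.
  by move=> jQ; rewrite qE // mono_mulE // subrr.
exists Q', u', a; split; split => //.
- move=> i; rewrite coef_poly; case: ifP => iQ; last exact: fg0.
  by apply: (@fg_div K R G F mu) => //; rewrite -qE.
- apply: (mono_inj nmu); rewrite mulr0; transitivity P0.[u - y] => //.
  rewrite !horner_poly mulr_sumr.
  apply: eq_bigr => j _; rewrite mulrA -qE // u'E exprMn monoX // /e.
  by rewrite [RHS]mulrA [b j * _]mulrC.
- by rewrite -u'E addrC subrK.
- move: ua; rewrite u'E => /eqP; change ((mono F a * u') a <> 0 -> u' 0 <> 0).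
  by rewrite mono_mulE // subrr.
- exists j0; rewrite coef_poly j0Q resq //.
  exact/eqP.
(* The exponent [a *+ m] occurs, so [mu] is at most [a *+ m], whereas for [j > m] the exponents of
   [e j] are at least [a *+ j], which is strictly larger because [a] is nonzero. *)
- apply/leq_sizeP => j mj; rewrite coef_map coef_poly.
  case: ifP => jQ; last exact: raddf0.
  change (res (q j) = 0); rewrite resq // eE; apply: not_supp => /ser_nn nj.
  have := nnD go nj (lmu _ Sam); rewrite addrC addrA subrK => nmj.
  apply: a0; apply: (@nnMn_eq0 _ _ go _ (j - m.+1)) => //.
  apply: (nn_anti go) => //.
  by rewrite -subSn // subSS mulrnBr ?opprB // ltnW.
- move=> j bj; rewrite coef_poly; case: ifP => // jQ.
  by apply: (mono_inj nmu); rewrite -qE // /e /b bj !mulr0.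
Qed.

Hypothesis charK : [pchar K] =i pred0.

(** Induction on the degree of the residue of [Q]. When some divided derivative of order at most [d]
    does not vanish at [res u], one Newton step brings the degree down to at most [d]. Otherwise the
    expansion point is a Hensel root of the divided derivative of order [d]. *)
Theorem fg_algebraically_closed Q u : fg_poly Q -> Q.[u] = 0 -> resp Q <> 0 -> fg u.
Proof.
suff main d : forall Q u, fg_poly Q -> Q.[u] = 0 -> resp Q <> 0 ->
    (size (resp Q) <= d.+1)%N -> fg u.
  by move=> fQ Qu rQ; apply: (main (size (resp Q)) Q).
have fgu u' a v y : fg y -> nn a -> v = y + mono F a * u' -> fg u' -> fg v.
  by move=> fy na -> fu'; apply: fgD => //; apply: fgM => //; apply: fg_mono.
have resN P y j : res P^`N(j).[y] = (resp P)^`N(j).[res y].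
  by rewrite nderivn_map horner_map.
have resp_neq0 P j : res P`_j <> 0 -> resp P <> 0.
  by move=> Pj /(congr1 (fun p : {poly K} => p`_j)); rewrite coef_map coef0.
elim: d => [|d IH] {}Q {}u fQ Qu rQ sQ.
  (* A residue that is a nonzero constant contradicts [Q.[u] = 0]. *)
  have /size_poly1P[k k0 Qk] : size (resp Q) == 1%N.
    by rewrite eqn_leq sQ lt0n size_poly_eq0; apply/eqP.
  have := horner_map (@res K R G F) Q u; rewrite Qk hornerC Qu rmorph0 => k0'.
  by rewrite k0' eqxx in k0.
(* If [res v] is not a root of maximal multiplicity, a constant [y] will do. *)
have low P v m : fg_poly P -> P.[v] = 0 -> (m <= d)%N ->
    (resp P)^`N(m).[res v] <> 0 -> fg v.
  move=> fP Pv md Pm; set y := cst F (res v).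
  have [->|vy] := pselect (v = y); first exact: fg_cst.
  have ry : res y = res v by rewrite res_cst.
  have Py : res P^`N(m).[y] <> 0 by rewrite resN ry.
  have [Q' [v' [a [[fQ' Qv' na vE] [_ [j Qj] sQ' _]]]]] :=
    newton_step fP Pv (fg_cst F _) ry vy Py.
  apply: (fgu _ _ _ _ (fg_cst F _) na vE); apply: (IH Q') => //.
    exact: resp_neq0 Qj.
  exact: leq_trans sQ' _.
have [sQd|sQd] := leqP (size (resp Q)) d.+1; first exact: (IH Q).
have {sQd}sQ : size (resp Q) = d.+2 by apply/eqP; rewrite eqn_leq sQ.
pose k := (resp Q)`_d.+1.
have k0 : k != 0 by rewrite /k -[d.+1]/d.+2.-1 -sQ -lead_coefE lead_coef_eq0; apply/eqP.
have natK i : (i.+1)%:R != 0 :> K by move/pcharf0P: charK => ->.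
have [Qd|/eqP Qd] := eqVneq (resp Q)^`N(d).[res u] 0; last exact: (low Q u d).
(* For the residue of [Q] this is linear with slope [d + 1] times [k], nonzero in characteristic
   zero: the form that [hensel] requires. *)
have derQ (p : {poly K}) : (size p <= d.+2)%N ->
    p^`N(d) = (p`_d.+1 *+ d.+1) *: 'X + (p`_d)%:P.
  move=> sp; apply/polyP => i; rewrite coef_nderivn coefD coefZ coefX coefC.
  case: i => [|[|i]] /=; rewrite ?addn0 ?addn1 ?binn ?binSn ?mulr0 ?mulr1 ?add0r ?addr0 ?mulr1n //.
  by rewrite nth_default ?mul0rn // (leq_trans sp) // addnS addnS ltnS ltnS leq_addr.
have [|||y [fy Qy ry]] := @hensel K R G F Q^`N(d) (k *+ d.+1) (res u).
- exact: fg_nderivn.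
- by rewrite -mulr_natr mulf_neq0.
- rewrite -nderivn_map derQ ?sQ // scalerBr; congr (_ + _); apply/eqP.
  rewrite -addr_eq0 -mul_polyC -polyCM -polyCD.
  by move: Qd; rewrite derQ ?sQ // hornerD hornerZ hornerX hornerC addrC -/k => ->.
have [->//|uy] := pselect (u = y).
have Qtop : res Q^`N(d.+1).[y] <> 0.
  rewrite resN (_ : (resp Q)^`N(d.+1) = k%:P) ?hornerC; first exact/eqP.
  apply/polyP => i; rewrite coef_nderivn coefC; case: i => [|i] /=.
    by rewrite addn0 binn mulr1n.
  by rewrite nth_default ?mul0rn // sQ addnS ltnS leq_addr.
have [Q' [u' [a [[fQ' Qu' na uE] [ru' [j Qj] sQ' Qd0]]]]] :=
  newton_step fQ Qu fy ry uy Qtop.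
apply: (fgu _ _ _ _ fy na uE).
(* By the choice of [y] the coefficient of degree [d] vanishes. Either the one of degree [d + 1]
   does too and the degree drops, or the divided derivative of order [d] is a nonzero multiple of
   [T], which does not vanish at [res u'], and [low] applies. *)
have Q'd : (resp Q')`_d = 0 by rewrite coef_map Qd0 //; apply: raddf0.
have [Q'S|/eqP Q'S] := eqVneq (resp Q')`_d.+1 0.
  apply: (IH Q') => //; first exact: resp_neq0 Qj.
  apply/leq_sizeP => i; rewrite leq_eqVlt => /predU1P[<-//|di].
  by rewrite nth_default // (leq_trans sQ').
apply: (low Q' u' d) => //; rewrite derQ // Q'd hornerD hornerC addr0 hornerZ hornerX.
by apply/eqP; rewrite mulf_neq0 ?(introN eqP ru') // -mulr_natr mulf_neq0 //; apply/eqP.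
Qed.

End AlgebraicallyClosed.

Section LaurentRoots.
Context {K : fieldType} {R : realType} {G : zmodType}.
Variable F : support_family R G.
Local Notation T := (ser K F).
Local Notation nn := (nn F).

Let go : group_order nn := sf_order F.

Lemma horner_serE (Q : {poly T}) (u : T) d c : (size Q <= d)%N ->
  Q.[u] c = \sum_(i < d) conv Q`_i (pow u i) c.
Proof.
move=> Qd; rewrite (horner_coef_wide _ Qd) ser_sumE; apply: eq_bigr => i _.
by rewrite serME serXE.
Qed.

Lemma shift_comp a b (f : G -> K) : shift a (shift b f) = shift (a + b) f.
Proof. by apply/funext => c; rewrite /shift opprD addrA. Qed.

(** Reduction to the ring: [xi] is written [x^a0 u], and the coefficient of degree [i] becomes
    [x^(a0 i - mu) P_i], where [mu] is the least exponent of all the [x^(a0 i) P_i]. The new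
    coefficients are [fg], and one of them has nonzero residue. *)
Lemma laurent_fg (charK : [pchar K] =i pred0) (xi : G -> K) (P : nat -> G -> K)
    (d : nat) (a0 : G) :
  algebraic_least (K := K) F ->
  least nn (supp xi) a0 -> fam F [set c | supp xi (c + a0)] ->
  (forall i, (i < d)%N -> exists g a, nonneg nn g /\
     forall c, supp (P i) c -> monoid g (c - a)) ->
  (exists2 i, (i < d)%N & supp (P i) !=set0) ->
  (forall c, \sum_(i < d) conv (P i) (pow xi i) c = 0) ->
  exists g, nonneg nn g /\ forall c, supp xi c -> monoid g (c - a0).
Proof.
move=> aleast [xia0 la0] Fxi Pg [i0 i0d Pi0] Psum.
have Hu : fam F (supp (shift (- a0) xi)).
  by apply: sf_sub Fxi => c; rewrite /supp /= /shift opprK.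
pose u : T := Ser Hu.
have xiE : xi = shift a0 u by rewrite /= shift_comp subrr; apply/funext => c; rewrite /shift subr0.
pose e i := shift (a0 *+ i) (P i).
have suppe i c : supp (e i) c = supp (P i) (c - a0 *+ i) by [].
have key i : exists m, (i < d)%N -> supp (P i) !=set0 -> least nn (supp (e i)) m.
  have [[id [c Pc]]|H] := pselect ((i < d)%N /\ supp (P i) !=set0); last first.
    by exists 0 => id Pi; case: H.
  have [g [a [gn Pga]]] := Pg i id.
  have [||m mP] := @least_monoid _ _ go g (a + a0 *+ i) (supp (e i)) gn.
  - by move=> x; rewrite suppe => /Pga; rewrite opprD addrA addrAC.
  - by exists (c + a0 *+ i); rewrite suppe addrK.
  by exists m.
have {key}[m mP] := choice key.
pose I := [seq i <- iota 0 d | `[< supp (P i) !=set0 >]].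
have memI i : (i \in I) = (i < d)%N && `[< supp (P i) !=set0 >].
  by rewrite mem_filter mem_iota add0n andbC.
have [mu [muI lmu]] : exists mu, least nn [set` map m I] mu.
  apply: (@least_seq _ _ go _ (m i0)); apply: map_f.
  by rewrite memI i0d; apply/asboolP.
have {muI}/mapP[i1 i1I mu1] : mu \in map m I by exact: muI.
have nmu i c : (i < d)%N -> supp (e i) c -> nn (c - mu).
  move=> id ec; have Pi : supp (P i) !=set0 by exists (c - a0 *+ i).
  have [_ /(_ _ ec) nc] := mP i id Pi.
  rewrite -(subrK (m i) c) -addrA; apply: (nnD go) => //.
  by apply: lmu; apply: map_f; rewrite memI id; apply/asboolP.
have /choice[q qP] : forall i, exists q : T,
    (i < d)%N -> q = shift (- mu) (e i) :> (G -> K) /\ fg q.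
  move=> i; have [id|] := boolP (i < d)%N; last by exists 0.
  have [g [a [gn Pga]]] := Pg i id.
  have [||g' [gn' qg']] := @monoid_absorb _ nn g (a + a0 *+ i - mu) (supp (shift (- mu) (e i))) gn.
  - move=> c; rewrite /supp /= /shift opprK => ec.
    by rewrite -(addrK mu c); apply: (nmu i).
  - move=> c; rewrite /supp /= /shift opprK => /Pga.
    by rewrite [c - (_ - _)](_ : _ = c + mu - a0 *+ i - a) //
      opprB addrA opprD [- a - _]addrC addrA.
  by exists (Ser (sf_sub qg' (sf_monoid gn'))) => _; split=> //; exists g'.
pose Q := \poly_(i < d) q i.
have fQ : fg_poly Q.
  by move=> i; rewrite coef_poly; case: ifP => [/qP[]//|_]; apply: fg0.
have Qu : Q.[u] = 0.
  apply/ser_inj/funext => c; rewrite (@horner_serE Q u d) ?size_poly //.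
  rewrite -[RHS](Psum (c + mu)); apply: eq_bigr => i _.
  rewrite coef_poly ltn_ord (qP i (ltn_ord i)).1 xiE pow_shift.
  rewrite -[X in _ = conv X _ _](_ : shift 0 (P i) = P i); last first.
    by apply/funext => x; rewrite /shift subr0.
  rewrite conv_shift add0r shift_comp.
  rewrite -[X in conv _ X](_ : shift 0 (pow u i) = pow u i); last first.
    by apply/funext => x; rewrite /shift subr0.
  by rewrite conv_shift addr0 /shift opprD opprK addrA.
have Q0 : map_poly (@res K R G F) Q <> 0.
  move: i1I; rewrite memI => /andP[i1d /asboolP Pi1].
  move=> /(congr1 (fun p : {poly K} => p`_i1)); rewrite coef_map coef_poly i1d coef0.
  change (q i1 0 <> 0); rewrite (qP i1 i1d).1 /shift opprK add0r.
  by have [/eqP] := mP i1 i1d Pi1; rewrite mu1.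
have [g [gn ug]] := fg_algebraically_closed aleast charK fQ Qu Q0.
by exists g; split=> // c xc; apply: ug; rewrite /supp /= /shift opprK subrK.
Qed.

End LaurentRoots.

(** * Lexicographic orders and their perturbations *)

Section Lexicographic.
Context {R : realType} {V : zmodType}.
Implicit Types (us : seq {additive V -> R}) (a b c x : V) (g : seq V) (w : {additive V -> R}).
Implicit Types S : set V.

Fixpoint lexnn us a : Prop :=
  if us is u :: us' then 0 < u a \/ (u a = 0 /\ lexnn us' a) else True.

Fixpoint vanish us a : Prop :=
  if us is u :: us' then u a = 0 /\ vanish us' a else True.

(* For small [t > 0] this single functional is positive on any given vector
   that is positive for the lexicographic order of [us]. *)
Fixpoint perturb us (t : R) a : R :=
  if us is u :: us' then u a + t * perturb us' t a else 0.

Lemma perturb_additive us t : zmod_morphism (perturb us t).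
Proof.
elim: us => [|u us IH] a b /=; first by rewrite subr0.
by rewrite raddfB IH mulrBr opprD addrACA.
Qed.
HB.instance Definition _ us t :=
  GRing.isZmodMorphism.Build V R (perturb us t) (perturb_additive us t).

Lemma lexnnD us a b : lexnn us a -> lexnn us b -> lexnn us (a + b).
Proof.
elim: us => //= u us IH [ua|[ua la]] [ub|[ub lb]]; rewrite raddfD.
- by left; apply: addr_gt0.
- by left; rewrite ub addr0.
- by left; rewrite ua add0r.
- by right; rewrite ua ub addr0; split=> //; apply: IH.
Qed.

Lemma lexnn_total us a : lexnn us a \/ lexnn us (- a).
Proof.
elim: us => /= [|u us IH]; first by left.
rewrite raddfN oppr_gt0; case: (ltgtP (u a) 0) => [ua|ua|ua]; [by right; left|by left; left|].
by rewrite ua oppr0; case: IH => la; [left|right]; right.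
Qed.

Lemma lexnn_vanish us a : lexnn us a -> lexnn us (- a) -> vanish us a.
Proof.
elim: us => //= u us IH; rewrite raddfN oppr_gt0 => -[ua|[ua la]] [ub|[ub lb]].
- by have := lt_trans ua ub; rewrite ltxx.
- by move/eqP: ub ua; rewrite oppr_eq0 => /eqP->; rewrite ltxx.
- by rewrite ua ltxx in ub.
- by split=> //; apply: IH.
Qed.

Lemma vanish_lexnn us a : vanish us a -> lexnn us a.
Proof. by elim: us => //= u us IH [ua /IH]; right. Qed.

Lemma vanish0 us : vanish us 0.
Proof. by elim: us => //= u us IH; rewrite raddf0. Qed.

Lemma vanishN us a : vanish us a -> vanish us (- a).
Proof. by elim: us => //= u us IH [ua /IH]; rewrite raddfN ua oppr0. Qed.

Lemma lexnn_order us : (forall a, vanish us a -> a = 0) -> group_order (lexnn us).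
Proof.
move=> us0; split; [exact: lexnnD | | exact: lexnn_total].
by move=> a la lNa; apply/us0/lexnn_vanish.
Qed.

Lemma perturb_bound us a : exists B : R, forall t, 0 < t -> t < 1 -> `|perturb us t a| <= B.
Proof.
elim: us => [|u us [B IH]] /=; first by exists 0 => t _ _; rewrite normr0.
exists (`|u a| + B) => t t0 t1; rewrite (le_trans (ler_normD _ _)) // lerD2l.
rewrite normrM (gtr0_norm t0) -[B]mul1r; apply: ler_pM => //; [exact: ltW|exact: ltW|].
exact: IH.
Qed.

(** The first functional that does not vanish at [a] is positive there; the later ones contribute
    [t] times a quantity bounded for [t < 1]. *)
Lemma perturb_pos us a : lexnn us a -> ~ vanish us a ->
  exists2 e : R, 0 < e & forall t, 0 < t < e -> 0 < perturb us t a.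
Proof.
elim: us => //= u us IH [ua _|[ua la] nv].
  have [B Bb] := perturb_bound us a.
  have B0 : 0 <= B by apply: le_trans (Bb (1 / 2) _ _);
    rewrite ?divr_gt0 // ltr_pdivrMr // mul1r ltr1n.
  have B1 : 0 < B + 1 by rewrite ltr_wpDl.
  exists (Num.min 1 (u a / (B + 1))); first by rewrite lt_min ltr01 divr_gt0.
  move=> t /andP[t0]; rewrite lt_min => /andP[t1]; rewrite ltr_pdivlMr // => tB.
  have := Bb t t0 t1; rewrite ler_norml => /andP[Bl _].
  rewrite -ltrBlDr sub0r -mulrN; apply: le_lt_trans tB.
  rewrite ler_pM2l //; rewrite lerNl; apply: le_trans Bl.
  by rewrite lerN2 lerDl.
have [|e e0 eP] := IH la; first by move=> va; apply: nv.
by exists e => // t te; rewrite ua add0r mulr_gt0 ?eP //; case/andP: te.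
Qed.

(** Otherwise [- a] would be strictly positive for the order, hence for every sufficiently small
    perturbation. *)
Lemma perturb_inv us a : (forall e : R, 0 < e -> exists2 t, 0 < t < e & 0 <= perturb us t a) ->
  lexnn us a.
Proof.
move=> H; case: (lexnn_total us a) => // lNa.
have [va|nva] := pselect (vanish us (- a)).
  by apply: vanish_lexnn; rewrite -(opprK a); apply: vanishN.
have [e e0 eP] := perturb_pos lNa nva; have [t te] := H e e0.
by have := eP t te; rewrite raddfN oppr_gt0 => /lt_le_trans/[apply]; rewrite ltxx.
Qed.

Lemma perturb_seq us g : (forall a, vanish us a -> a = 0) -> nonneg (lexnn us) g ->
  exists2 e : R, 0 < e & forall t, 0 < t < e ->
    forall x, x \in g -> x != 0 -> 0 < perturb us t x.
Proof.
move=> us0; elim: g => [|x g IH] gn; first by exists 1.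
have [|e e0 eP] := IH; first by move=> y yg; apply: gn; rewrite inE yg orbT.
have [x0|x0] := eqVneq x 0.
  by exists e => // t /eP te y; rewrite inE => /predU1P[->|/te//]; rewrite x0 eqxx.
have [||e' e'0 e'P] := @perturb_pos us x.
- by apply: gn; rewrite mem_head.
- by move/us0 => xE; rewrite xE eqxx in x0.
exists (Num.min e e'); first by rewrite lt_min e0.
move=> t /andP[t0]; rewrite lt_min => /andP[te te'] y.
rewrite inE => /predU1P[-> _|yg y0]; first by apply: e'P; rewrite t0.
by apply: (eP t) => //; rewrite t0.
Qed.

(** The support condition of a Novikov ring. *)
Definition finsub (w : V -> R) S := forall C, finite_set (S `&` [set a | w a <= C]).

Lemma finsub_sub w S S' : S `<=` S' -> finsub w S' -> finsub w S.
Proof. by move=> SS' fS' C; apply: sub_finite_set (fS' C) => a [/SS']. Qed.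

Lemma finsubU w S S' : finsub w S -> finsub w S' -> finsub w (S `|` S').
Proof. by move=> fS fS' C; rewrite setIUl finite_setU. Qed.

Lemma finsub_lower w S : finsub w S -> exists B, forall a, S a -> B <= w a.
Proof.
move=> fS; have /finite_seqP[s sE] := fS 0.
have [B [B0 BP]] : exists B : R, B <= 0 /\ forall a, a \in s -> B <= w a.
  elim: s {sE} => [|x s [B [B0 BP]]]; first by exists 0.
  exists (Num.min B (w x)); split; first by rewrite ge_min B0.
  by move=> a; rewrite inE ge_min => /predU1P[->|/BP->//]; rewrite lexx orbT.
exists B => a Sa; have [wa|/ltW wa] := leP (w a) 0; last exact: le_trans wa.
by apply: BP; have : [set` s] a by rewrite -sE.
Qed.

Lemma finsub_add w S S' : finsub w S -> finsub w S' -> finsub w (set_add S S').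
Proof.
move=> fS fS' C; have [B BP] := finsub_lower fS; have [B' BP'] := finsub_lower fS'.
apply: (@sub_finite_set _ _ ((fun p => p.1 + p.2) @`
  ((S `&` [set a | w a <= C - B']) `*` (S' `&` [set a | w a <= C - B])))).
  move=> c [[a Sa S'c] wc]; exists (a, c - a); last by rewrite /= addrC subrK.
  have := BP _ Sa; have := BP' _ S'c; rewrite raddfB => B'c Ba.
  split; split=> //=; last by rewrite raddfB lerB.
  by rewrite lerBrDr -lerBrDl (le_trans B'c) // lerB.
by apply: finite_image; apply: finite_setX.
Qed.

Lemma finsub_fin w S S' c : finsub w S -> finsub w S' ->
  finite_set [set a | S a /\ S' (c - a)].
Proof.
move=> fS fS'; have [B' BP'] := finsub_lower fS'.
apply: sub_finite_set (fS (w c - B')) => a [Sa /BP']; rewrite raddfB => Ba.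
by split=> //=; rewrite lerBrDr -lerBrDl.
Qed.

Lemma finsub_shift w S a : finsub w S -> finsub w [set c | S (c + a)].
Proof.
move=> fS C; apply: (@sub_finite_set _ _ ((fun c => c - a) @` (S `&` [set c | w c <= C + w a]))).
  by move=> c [Sc wc]; exists (c + a); [split=> //=; rewrite raddfD lerD2r | rewrite addrK].
exact/finite_image/fS.
Qed.

Lemma finsub_monoid w g : (forall x, x \in g -> x != 0 -> 0 < w x) -> finsub w (monoid g).
Proof.
elim: g => [|x g IH] gw C /=.
  by apply: sub_finite_set (finite_set1 0) => a [].
have {}IH : finsub w (monoid g) by apply: IH => y yg; apply: gw; rewrite inE yg orbT.
have [x0|x0] := eqVneq x 0.
  apply: sub_finite_set (IH C) => a [[k]]; rewrite x0 mul0rn subr0 //.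
have wx : 0 < w x by apply: gw; rewrite ?mem_head.
have wg a : monoid g a -> 0 <= w a.
  apply: (monoid_min (S := [set a | 0 <= w a])) => [|b c|y yg] /=.
  - by rewrite raddf0.
  - by rewrite raddfD; apply: addr_ge0.
  - have [->|y0] := eqVneq y 0; first by rewrite raddf0.
    by apply/ltW/gw; rewrite // inE yg orbT.
apply: (@sub_finite_set _ _ ((fun p => x *+ p.1 + p.2) @`
   (`I_(Num.truncn (C / w x)).+1 `*` (monoid g `&` [set a | w a <= C])))); last first.
  by apply: finite_image; apply: finite_setX; [apply: finite_II | apply: IH].
move=> a [[k ga] /= wa]; exists (k, a - x *+ k); last by rewrite /= addrC subrK.
have := wg _ ga; rewrite raddfB raddfMn subr_ge0 => kx.
split=> /=; first last.
  split=> //=; apply: le_trans wa.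
  by rewrite gerBl mulrn_wge0 // ltW.
have kC : k%:R <= C / w x by rewrite ler_pdivlMr // mulr_natl (le_trans kx).
by rewrite -(ltr_nat R) (le_lt_trans kC) // truncnS_gt.
Qed.

Lemma least_finsub us w S : group_order (lexnn (w :: us)) -> finsub w S -> S !=set0 ->
  exists a, least (lexnn (w :: us)) S a.
Proof.
move=> go fS [s Ss].
have [|a [[Sa wa] la]] := least_finite go (fS (w s)); first by exists s; split=> /=.
exists a; split=> // b Sb; have [ws|ws] := leP (w b) (w s); first exact: la.
by left; rewrite raddfB subr_gt0 (le_lt_trans wa).
Qed.

End Lexicographic.

(** * Two rings of series attached to a lexicographic order *)

Section Families.
Context {R : realType} {G : zmodType}.
Variable us : seq {additive G -> R}.
Hypothesis us0 : forall a, vanish us a -> a = 0.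
Implicit Types (S T : set G) (g : seq G) (a b c : G).

Let go := lexnn_order us0.

Lemma monoid_weight g : nonneg (lexnn us) g ->
  exists l : {additive G -> R}, forall x, x \in g -> x != 0 -> 0 < l x.
Proof.
move=> gn; have [e e0 eP] := perturb_seq us0 gn.
have e2 : 0 < e / 2 < e by rewrite divr_gt0 // ltr_pdivrMr // ltr_pMr // ltr1n.
by exists (perturb us (e / 2)) => x; apply: eP.
Qed.

(** A germ at [t = 0]: the finiteness concerns the small perturbations, since the first functional
    itself may have infinite sublevels. *)
Definition germ_fam S := S `<=` lexnn us /\
  exists2 e : R, 0 < e & forall t, 0 < t < e -> finsub (perturb us t) S.

Lemma germ2 S T (X : R -> Prop) : germ_fam S -> germ_fam T ->
  (forall t, finsub (perturb us t) S -> finsub (perturb us t) T -> X t) ->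
  exists2 e : R, 0 < e & forall t, 0 < t < e -> X t.
Proof.
move=> [_ [e e0 eP]] [_ [e' e'0 e'P]] H; exists (Num.min e e'); first by rewrite lt_min e0.
move=> t /andP[t0]; rewrite lt_min => /andP[te te'].
by apply: H; [apply: eP|apply: e'P]; rewrite t0.
Qed.

Lemma lexnn_set_add S T : S `<=` lexnn us -> T `<=` lexnn us -> set_add S T `<=` lexnn us.
Proof.
by move=> Sn Tn c [a /Sn Sa /Tn Ta]; rewrite -(subrK a c) addrC; apply: lexnnD.
Qed.

Definition germ_family : support_family R G.
Proof.
refine (@SupportFamily R G (lexnn us) germ_fam go _ _ _ _ _ _ _ monoid_weight).
- by move=> S [].
- move=> S T ST [Tn [e e0 eP]]; split; first exact: subset_trans Tn.
  by exists e => // t /eP; apply: finsub_sub.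
- move=> S T fS fT; split; first by rewrite subUset; split; [apply: fS.1|apply: fT.1].
  by apply: germ2 fS fT _ => t; apply: finsubU.
- move=> S T fS fT; split; first by apply: lexnn_set_add; [apply: fS.1|apply: fT.1].
  by apply: germ2 fS fT _ => t; apply: finsub_add.
- move=> S T c fS fT.
  have [e e0 eP] := germ2 fS fT (fun t fSt fTt => finsub_fin c fSt fTt).
  by apply: (eP (e / 2)); rewrite divr_gt0 // ltr_pdivrMr // ltr_pMr // ltr1n.
- move=> S a [_ [e e0 eP]] Sa; split; first by move=> c /Sa; rewrite addrK.
  by exists e => // t /eP; apply: finsub_shift.
- move=> g gn; split; first exact: nn_monoid gn.
  have [e e0 eP] := perturb_seq us0 gn.
  by exists e => // t te; apply: finsub_monoid => x; apply: eP.
Defined.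

Variable w : {additive G -> R}.
Hypothesis w_lexnn : forall a, lexnn us a -> 0 <= w a.

(** Products remain in the family because [w] is nonnegative on the supports: the factors of a term
    weigh at most as much as the term. *)
Definition locally_fg S := S `<=` lexnn us /\
  forall C, exists g, nonneg (lexnn us) g /\ S `&` [set a | w a <= C] `<=` monoid g.

Lemma monoid_add_cat g g' : set_add (monoid g) (monoid g') `<=` monoid (g ++ g').
Proof.
move=> c [a ga ga']; rewrite -(subrK a c) addrC; apply: monoidD.
  by apply: monoid_sub ga => x xg; rewrite mem_cat xg.
by apply: monoid_sub ga' => x xg; rewrite mem_cat xg orbT.
Qed.

Lemma locally_fg2 S T C : locally_fg S -> locally_fg T ->
  exists g, nonneg (lexnn us) g /\
    (S `&` [set a | w a <= C] `<=` monoid g /\ T `&` [set a | w a <= C] `<=` monoid g).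
Proof.
move=> [_ fS] [_ fT]; have [g [gn gS]] := fS C; have [g' [gn' gT]] := fT C.
exists (g ++ g'); split; first exact: nn_cat.
split=> a; first by move/gS; apply: monoid_sub => x xg; rewrite mem_cat xg.
by move/gT; apply: monoid_sub => x xg; rewrite mem_cat xg orbT.
Qed.

Lemma locally_fg_split S T c a : S `<=` lexnn us -> T `<=` lexnn us -> S a -> T (c - a) ->
  w a <= w c /\ w (c - a) <= w c.
Proof.
move=> Sn Tn /Sn/w_lexnn wa /Tn/w_lexnn; rewrite raddfB subr_ge0 => ac.
by split=> //; rewrite gerBl.
Qed.

Definition locally_fg_family : support_family R G.
Proof.
refine (@SupportFamily R G (lexnn us) locally_fg go _ _ _ _ _ _ _ monoid_weight).
- by move=> S [].
- move=> S T ST [Tn fT]; split; first exact: subset_trans Tn.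
  by move=> C; have [g [gn gT]] := fT C; exists g; split=> // a [/ST Ta wa]; apply: gT.
- move=> S T fS fT; split; first by rewrite subUset; split; [apply: fS.1|apply: fT.1].
  move=> C; have [g [gn [gS gT]]] := locally_fg2 C fS fT; exists g; split=> //.
  by rewrite setIUl subUset.
- move=> S T fS fT; split; first by apply: lexnn_set_add; [apply: fS.1|apply: fT.1].
  move=> C; have [g [gn [gS gT]]] := locally_fg2 C fS fT; exists (g ++ g).
  split; first exact: nn_cat.
  move=> c [[a Sa Ta] /= wc]; have [wa wca] := locally_fg_split fS.1 fT.1 Sa Ta.
  apply: monoid_add_cat; exists a; first by apply: gS; split=> //=; apply: le_trans wc.
  by apply: gT; split=> //; apply: le_trans wc.
- move=> S T c fS fT; have [g [gn [gS gT]]] := locally_fg2 (w c) fS fT.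
  have [l lg] := monoid_weight gn.
  apply: sub_finite_set (finsub_fin c (finsub_monoid lg) (finsub_monoid lg)).
  move=> a [Sa Ta]; have [wa wca] := locally_fg_split fS.1 fT.1 Sa Ta.
  by split; [apply: gS | apply: gT].
- move=> S a [Sn fS] Sa; have Sa' : [set c | S (c + a)] `<=` lexnn us.
    by move=> c /Sa; rewrite addrK.
  split=> // C; have [g [gn gS]] := fS (C + w a).
  have [||g' [gn' g'S]] := @monoid_absorb _ (lexnn us) g (- a)
      ([set c | S (c + a)] `&` [set c | w c <= C]) gn.
  - by move=> c [/Sa' ].
  - by move=> c [Sc wc]; rewrite opprK; apply: gS; split=> //=; rewrite raddfD lerD2r.
  by exists g'.
- move=> g gn; split; first exact: nn_monoid gn.
  by move=> C; exists g; split=> // a [].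
Defined.

End Families.

(** * Least exponents of algebraic series *)

Section AlgebraicLeast.
Context {K : fieldType} {R : realType} {G : zmodType}.
Variable us : seq {additive G -> R}.
Hypothesis us0 : forall a, vanish us a -> a = 0.
Implicit Types (S T : set G) (g : seq G) (a b c : G).

Let go := lexnn_order us0.

(** If each index failed below some threshold, all would fail below the least of these finitely many
    thresholds. *)
Lemma pigeonhole_germ (I : eqType) (s : seq I) (X : I -> R -> Prop) :
  (forall e : R, 0 < e -> exists2 t, 0 < t < e & exists2 i, i \in s & X i t) ->
  exists2 i, i \in s & forall e : R, 0 < e -> exists2 t, 0 < t < e & X i t.
Proof.
apply: contraPP => ns; have [e e0 eP] : exists2 e : R, 0 < e &
    forall i, i \in s -> forall t, 0 < t < e -> ~ X i t.
  elim: s ns => [|i s IH] ns; first by exists 1.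
  have [|e e0 eP] := IH.
    by move=> [j js H]; apply: ns; exists j; rewrite // inE js orbT.
  have /existsNP[e' /not_implyP[e'0 e'P]] :
      ~ forall e : R, 0 < e -> exists2 t, 0 < t < e & X i t.
    by move=> H; apply: ns; exists i; rewrite ?mem_head.
  exists (Num.min e e'); first by rewrite lt_min e0.
  move=> j; rewrite inE => /predU1P[->|js] t /andP[t0]; rewrite lt_min => /andP[te te'] Xt.
    by apply: e'P; exists t; rewrite ?t0.
  by apply: (eP j js t) Xt; rewrite t0.
by move=> /(_ e e0)[t te [i si Xi]]; apply: (eP i si t te).
Qed.

Lemma least_unique nn S a b : group_order nn -> least nn S a -> least nn S b -> a = b.
Proof.
move=> gn [Sa la] [Sb lb]; apply/eqP; rewrite -subr_eq0; apply/eqP/(nn_anti gn).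
  exact: lb.
by rewrite opprB; apply: la.
Qed.

(* Newton's polygon leaves finitely many candidates for the least exponent of
   [u] with respect to [perturb us t], so one of them serves for arbitrarily
   small [t]. *)
Lemma algebraic_germ_least (u : G -> K) d (b : nat -> G -> K) :
  (exists2 e : R, 0 < e & forall t, 0 < t < e -> finsub (perturb us t) (supp u)) ->
  supp u !=set0 ->
  (forall i, (i < d)%N -> exists g a0, nonneg (lexnn us) g /\
     forall a, supp (b i) a -> monoid g (a - a0)) ->
  (exists2 i, (i < d)%N & supp (b i) !=set0) ->
  (forall c, \sum_(i < d) conv (b i) (pow u i) c = 0) ->
  exists a, least (lexnn us) (supp u) a.
Proof.
move=> [e1 e10 fu] u0 bg bi0 sum0.
(* The list [us] breaks the ties of the perturbed weight, which alone need not be injective. *)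
pose vs t : seq {additive G -> R} := @cons {additive G -> R} (perturb us t) us.
have gt t : group_order (lexnn (vs t)).
  by apply: lexnn_order => a [_ /us0].
have /choice[be beP] i : exists c, (i < d)%N -> supp (b i) !=set0 ->
    exists2 e : R, 0 < e & forall t, 0 < t < e -> least (lexnn (vs t)) (supp (b i)) c.
  have [[id bi]|H] := pselect ((i < d)%N /\ supp (b i) !=set0); last first.
    by exists 0 => id bi; case: H.
  have [g [a0 [gn bga]]] := bg i id.
  have [c [bc lc]] := least_monoid go gn bga bi.
  exists c => _ _.
  (* The exponents of [b i], measured from the least one, lie in a monoid with finitely many
     nonnegative generators; these stay nonnegative for all small [t], so [c] remains the least
     exponent. *)
  have [||g' [gn' g'b]] := @monoid_absorb _ (lexnn us) g (a0 - c)
    [set x | supp (b i) (x + c)] gn.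
  - by move=> x /lc; rewrite addrK.
  - by move=> x /bga; rewrite opprB addrA.
  have [e e0 eP] := perturb_seq us0 gn'.
  exists e => // t te; split=> // x bx.
  apply: (nn_monoid (gt t) (g := g')); last by apply: g'b; rewrite /= subrK.
  move=> y yg; have [->|y0] := eqVneq y 0; first exact: nn0 (gt t).
  by left; apply: (eP t).
have [e2 e20 e2P] : exists2 e : R, 0 < e & forall i, (i < d)%N -> supp (b i) !=set0 ->
    forall t, 0 < t < e -> least (lexnn (vs t)) (supp (b i)) (be i).
  elim: (d) beP => [|k IH] beP; first by exists 1.
  have [|e e0 eP] := IH; first by move=> i /ltnW ik; apply: beP.
  have [bk|nbk] := pselect (supp (b k) !=set0); last first.
    by exists e => // i; rewrite ltnS leq_eqVlt => /predU1P[->|/eP//] bk; case: nbk.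
  have [e' e'0 e'P] := beP k (ltnSn k) bk.
  exists (Num.min e e'); first by rewrite lt_min e0.
  move=> i; rewrite ltnS leq_eqVlt => ik bi t /andP[t0]; rewrite lt_min => /andP[te te'].
  case/predU1P: ik => [->|ik]; first by apply: e'P; rewrite t0.
  by apply: (eP i) => //; rewrite t0.
pose X (p : nat * nat) t := (p.1 < p.2)%N /\
  exists2 a, least (lexnn (vs t)) (supp u) a & be p.1 + a *+ p.1 = be p.2 + a *+ p.2.
have [|[i j] _ XP] := @pigeonhole_germ _ [seq (i, j) | i <- iota 0 d, j <- iota 0 d] X.
- move=> e e0; pose t := (Num.min e (Num.min e1 e2)) / 2.
  have m0 : 0 < Num.min e (Num.min e1 e2) by rewrite !lt_min e0 e10.
  have : 0 < t < Num.min e (Num.min e1 e2).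
    by rewrite divr_gt0 // ltr_pdivrMr // ltr_pMr // ltr1n.
  move=> /andP[t0]; rewrite !lt_min => /and3P[te te1 te2].
  exists t; first by rewrite t0.
  have [|a la] := least_finsub (gt t) _ u0; first by apply: fu; rewrite t0.
  have t02 : 0 < t < e2 by rewrite t0.
  have [i [j [bi [bj [/andP[ij jd] li lj eij]]]]] := newton (gt t) la
    (fun i id bi => ex_intro _ _ (e2P i id bi t t02)) bi0 sum0.
  have id := ltn_trans ij jd.
  exists (i, j).
    by apply/allpairsP; exists (i, j); rewrite !mem_iota.
  split=> //=; exists a => //.
  rewrite (least_unique (gt t) (e2P i id (ex_intro _ _ li.1) t t02) li).
  by rewrite (least_unique (gt t) (e2P j jd (ex_intro _ _ lj.1) t t02) lj).
have [t0 _ [/= ij [a la aE]]] := XP 1 ltr01.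
exists a; split; first exact: la.1.
move=> x ux; apply: perturb_inv => e e0; have [t te [_ [/= a' la' a'E]]] := XP e e0.
(* The pair [(i, j)] determines the exponent: [a] and [a'] have the same multiple by [j - i], and an
   ordered group has no torsion. *)
exists t => //; suff aa' : a = a'.
  by have [_ /(_ _ ux)] := la'; rewrite -aa' /= => -[/ltW|[->]].
have ji k : (k = a \/ k = a') -> k *+ (j - i) = be i - be j.
  move=> H; have kE : be i + k *+ i = be j + k *+ j by case: H => ->.
  by rewrite mulrnBr ?(ltnW ij) //; apply/eqP; rewrite subr_eq addrAC kE [be j + _]addrC addrK.
apply: (mulrIn_group go (k := (j - i).-1)).
by rewrite prednK ?subn_gt0 // !ji; [|right|left].
Qed.

Lemma germ_algebraic_least : algebraic_least (K := K) (germ_family us0).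
Proof.
move=> Q u fQ Q0 u0 Qu; apply: (@algebraic_germ_least u (size Q) (fun i => Q`_i)).
- exact: (ser_supp u).2.
- exact: ser_neq0.
- move=> i _; have [g [gn Qg]] := fQ i; exists g, 0; split=> // a.
  by rewrite subr0; apply: Qg.
- exists (size Q).-1; first by rewrite ltn_predL lt0n size_poly_eq0; apply/eqP.
  by apply: ser_neq0; apply/eqP; rewrite -lead_coefE lead_coef_eq0; apply/eqP.
- by move=> c; rewrite -horner_serE // Qu.
Qed.

(** A sublevel of [w] lies in a finitely generated monoid and so has a least element, and anything
    of larger weight is larger for the order. *)
Lemma locally_fg_least (w : {additive G -> R})
    (w_lexnn : forall a, lexnn us a -> 0 <= w a)
    (lexnn_w : forall a, 0 < w a -> lexnn us a) :
  algebraic_least (K := K) (locally_fg_family us0 w_lexnn).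
Proof.
move=> Q u _ _ /ser_neq0[s su] _; have [un fu] := ser_supp u.
have [g [gn ug]] := fu (w s).
have [||a [[ua wa] la]] := least_monoid go (a0 := 0) (S := supp u `&` [set a | w a <= w s]) gn.
- by move=> a; rewrite subr0; apply: ug.
- by exists s; split=> /=.
exists a; split=> // b ub; have [ws|ws] := leP (w b) (w s); first exact: la.
by apply: lexnn_w; rewrite raddfB subr_gt0 (le_lt_trans wa).
Qed.

End AlgebraicLeast.

(** * Weights and cones *)

Section Weights.
Context {R : realType} {n : nat}.
Local Notation V := 'rV[R]_n.
Local Notation G := 'rV[rat]_n.
Implicit Types (u v : V) (us : seq V) (a b c : G) (g : seq G).
Local Notation real a := (real_exponent (R := R) a).

Lemma dotE u v : dot u v = \sum_j u 0 j * v 0 j.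
Proof. by rewrite /dot mxE; apply: eq_bigr => j _; rewrite mxE. Qed.

Lemma dotC u v : dot u v = dot v u.
Proof. by rewrite !dotE; apply: eq_bigr => j _; rewrite mulrC. Qed.

Lemma dotBl u v w : dot (u - v) w = dot u w - dot v w.
Proof. by rewrite /dot mulmxBl !mxE. Qed.

Lemma dotDl u v w : dot (u + v) w = dot u w + dot v w.
Proof. by rewrite /dot mulmxDl !mxE. Qed.

Lemma dotZl k u v : dot (k *: u) v = k * dot u v.
Proof. by rewrite /dot -scalemxAl !mxE. Qed.

Lemma dotDr u v w : dot u (v + w) = dot u v + dot u w.
Proof. by rewrite dotC dotDl !(dotC u). Qed.

Lemma dotZr k u v : dot u (k *: v) = k * dot u v.
Proof. by rewrite dotC dotZl dotC. Qed.

Lemma dot_delta u j : dot u (delta_mx 0 j) = u 0 j.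
Proof.
rewrite dotE (bigD1 j) //= big1 ?addr0 => [|i ij]; first by rewrite mxE !eqxx mulr1.
by rewrite mxE eqxx (negPf ij) mulr0.
Qed.

Definition wtv u : V -> R := dot^~ u.
Lemma wtv_additive u : zmod_morphism (wtv u).
Proof. by move=> v w; apply: dotBl. Qed.
HB.instance Definition _ u := GRing.isZmodMorphism.Build V R (wtv u) (wtv_additive u).

Lemma real_exponentB a b : real (a - b) = real a - real b.
Proof. exact: map_mxB. Qed.

Lemma real_exponent_inj a : real a = 0 -> a = 0.
Proof.
move=> /matrixP a0; apply/matrixP => i j; have := a0 i j; rewrite !mxE => /eqP.
by rewrite fmorph_eq0 => /eqP.
Qed.

Definition wt u : G -> R := fun a => dot (real a) u.
Lemma wt_additive u : zmod_morphism (wt u).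
Proof. by move=> a b; rewrite /wt real_exponentB dotBl. Qed.
HB.instance Definition _ u := GRing.isZmodMorphism.Build G R (wt u) (wt_additive u).

Definition wtvs us : seq {additive V -> R} := [seq (wtv u : {additive V -> R}) | u <- us].
Definition wts us : seq {additive G -> R} := [seq (wt u : {additive G -> R}) | u <- us].

Lemma lexnn_wts us a : lexnn (wts us) a = lexnn (wtvs us) (real a).
Proof. by elim: us => //= u us ->. Qed.

Lemma vanish_wts us a : vanish (wts us) a = vanish (wtvs us) (real a).
Proof. by elim: us => //= u us ->. Qed.

Lemma lex_preorderE us v w : lex_preorder us v w <-> lexnn (wtvs us) (w - v).
Proof.
rewrite /lex_preorder; elim: us => [|u us IH] /=; first by [].
rewrite Order.SeqLexiOrder.Exports.lexi_cons /wtv dotBl subr_gt0.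
split=> [/andP[]|].
  rewrite le_eqVlt => /predU1P[-> |]; last by left.
  by rewrite lexx subrr /= => /IH; right.
case=> [vw|[/eqP + /IH H]]; first by rewrite (ltW vw) leNgt vw.
by rewrite subr_eq0 => /eqP->; rewrite lexx implyTb.
Qed.

Lemma lexnn_scale us v k : 0 <= k -> lexnn (wtvs us) v -> lexnn (wtvs us) (k *: v).
Proof.
rewrite le_eqVlt => /predU1P[<- _|k0].
  by apply: vanish_lexnn; rewrite scale0r; apply: vanish0.
elim: us => //= u us IH; rewrite /wtv dotZl => -[uv|[-> /IH]].
  by left; apply: mulr_gt0.
by rewrite mulr0; right.
Qed.

Lemma antisymmetric_vanish us : antisymmetric (lex_preorder us) ->
  forall a, vanish (wts us) a -> a = 0.
Proof.
move=> anti a; rewrite vanish_wts => va; apply: real_exponent_inj; apply: anti.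
apply/andP; split; apply/lex_preorderE; apply: vanish_lexnn.
  by rewrite sub0r; apply: vanishN.
by rewrite subr0.
Qed.

Lemma positive_lexnn us v : positive_order (lex_preorder us) -> orthant R n v ->
  lexnn (wtvs us) v.
Proof. by move=> pos /pos/lex_preorderE; rewrite subr0. Qed.

Lemma refines_ge0 us u : refines (lex_preorder us) (omega_preorder u) ->
  forall v, lexnn (wtvs us) v -> 0 <= dot v u.
Proof.
move=> ref v lv; have := ref 0 v; rewrite omega_preorderE /dot mul0mx mxE.
by apply; apply/lex_preorderE; rewrite subr0.
Qed.

Lemma lexnn_gt0 us u : refines (lex_preorder us) (omega_preorder u) ->
  forall a, 0 < wt u a -> lexnn (wts us) a.
Proof.
move=> ref a ua; case: (lexnn_total (wts us) a) => // lNa; move: ua.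
rewrite ltNge -oppr_ge0 -raddfN /wt => /negP[].
by apply: refines_ge0 ref _ _; rewrite -lexnn_wts.
Qed.

Lemma conic_hullD m (M : 'M[R]_(m, n)) v w :
  conic_hull M v -> conic_hull M w -> conic_hull M (v + w).
Proof.
move=> [c c0 ->] [d d0 ->]; exists (c + d); last by rewrite mulmxDl.
by move=> i; rewrite mxE addr_ge0.
Qed.

Lemma conic_hullZ m (M : 'M[R]_(m, n)) k v : 0 <= k -> conic_hull M v -> conic_hull M (k *: v).
Proof.
move=> k0 [c c0 ->]; exists (k *: c); last by rewrite -scalemxAl.
by move=> i; rewrite mxE mulr_ge0.
Qed.

Lemma conic_hull0 m (M : 'M[R]_(m, n)) : conic_hull M 0.
Proof. by exists 0; rewrite ?mul0mx // => i; rewrite mxE. Qed.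

Lemma conic_hull_row m (M : 'M[R]_(m, n)) i : conic_hull M (row i M).
Proof. by exists (delta_mx 0 i); [move=> j; rewrite mxE ler0n | rewrite rowE]. Qed.

Lemma lexnn_conic_hull us m (M : 'M[R]_(m, n)) :
  (forall i, lexnn (wtvs us) (row i M)) -> conic_hull M `<=` lexnn (wtvs us).
Proof.
move=> Mn v [c c0 ->]; rewrite mulmx_sum_row; apply: big_ind => [|x y|i _].
- exact/vanish_lexnn/vanish0.
- exact: lexnnD.
- exact: lexnn_scale.
Qed.

Lemma common_denominator a : exists (k : nat) (z : 'rV[int]_n), a *+ k.+1 = map_mx intr z.
Proof.
pose dn := (\prod_j `|denq (a ord0 j)|)%N.
have dn0 : (0 < dn)%N by rewrite prodn_gt0 // => j; rewrite absz_gt0 denq_eq0.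
exists dn.-1; rewrite prednK //.
exists (\row_j (numq (a 0 j) * (\prod_(i | i != j) `|denq (a ord0 i)|)%N%:Z)).
apply/matrixP => i j; rewrite (ord1 i) mulmxnE !mxE /dn (bigD1 j) //=.
rewrite intrM mulrnA -mulr_natr; congr (_ * _).
by rewrite -mulr_natr -{1}(divq_num_den (a 0 j)) natr_absz gtr0_norm ?denq_gt0 //
  mulfVK // intr_eq0 denq_eq0.
Qed.

(** Each generator is multiplied by a common denominator of its coordinates; a positive factor
    alters neither its ray nor its sign. *)
Lemma monoid_conic_hull g : exists m (M : 'M[int]_(m, n)),
  (forall a, monoid g a -> conic_hull (map_mx intr M) (real a)) /\
  forall us, nonneg (lexnn (wts us)) g ->
    forall i, lexnn (wtvs us) (row i (map_mx intr M : 'M[R]_(m, n))).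
Proof.
have /choice[kz kzP] a : exists kz : nat * 'rV[int]_n, a *+ kz.1.+1 = map_mx intr kz.2.
  by have [k [z kz]] := common_denominator a; exists (k, z).
pose M := \matrix_(i < size g) (kz g`_i).2.
have rowM i : row i (map_mx intr M : 'M[R]__) = (kz g`_i).1.+1%:R *: real g`_i.
  rewrite -map_row rowK; apply/matrixP => i1 j; rewrite !mxE.
  have /matrixP/(_ i1 j) := kzP g`_i; rewrite !mxE mulmxnE => /(congr1 (@ratr R)).
  by rewrite ratr_int rmorphMn /= => <-; rewrite mulr_natl.
exists (size g), M; split=> [a|us gn i]; last first.
  rewrite rowM; apply: lexnn_scale => //; rewrite -lexnn_wts; apply: gn.
  exact: mem_nth.
apply: (monoid_min (S := [set a | conic_hull _ (real a)])) => [|b c|x] /=.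
- rewrite (_ : real 0 = 0); first exact: conic_hull0.
  by rewrite /real_exponent map_mx0.
- by rewrite {3}/real_exponent map_mxD; apply: conic_hullD.
- move=> /(nthP 0)[i ig <-]; rewrite -[real _](scalerK (a := (kz g`_i).1.+1%:R)) ?pnatr_eq0 //.
  rewrite -(rowM (Ordinal ig)); apply: conic_hullZ; first by rewrite invr_ge0.
  exact: conic_hull_row.
Qed.

End Weights.

(** * Algebraic series and the fields of the orders *)

Section AlgebraicSeries.
Context {K : fieldType} {R : realType} {n : nat}.
Local Notation V := 'rV[R]_n.
Local Notation G := 'rV[rat]_n.
Implicit Types (u v : V) (us : seq V) (a b c : G) (g : seq G) (xi : series K n).
Local Notation real a := (real_exponent (R := R) a).

Definition units : seq G := [seq delta_mx 0 j | j <- enum 'I_n].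

Lemma orthant_monoid a : integer_points a -> orthant R n (real a) -> monoid units a.
Proof.
move=> [z ->] z0; rewrite (row_sum_delta (map_mx intr z : G)).
apply: big_ind => [|x y|j _]; [exact: monoid0 | exact: monoidD |].
have /natrP[k kE] : (z 0 j)%:~R \is a @Num.nat rat.
  by rewrite natrEint intr_int /= ler0z; have := z0 j; rewrite !mxE ratr_int ler0z.
rewrite mxE kE scaler_nat; elim: k {kE} => [|k IH]; first exact: monoid0.
rewrite mulrS; apply: monoidD => //; apply: monoid_mem.
by apply: map_f; rewrite mem_enum.
Qed.

Lemma units_nonneg us : positive_order (lex_preorder us) -> nonneg (lexnn (wts us)) units.
Proof.
move=> pos a /mapP[j _ ->]; rewrite lexnn_wts; apply: positive_lexnn => // i.
by rewrite !mxE; case: eqP => //= _; case: eqP => //= _; rewrite ?rmorph1 ?rmorph0.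
Qed.

Lemma fg_order_series us xi a0 g : Supp xi `<=` integer_points -> Supp xi a0 ->
  nonneg (lexnn (wts us)) g -> (forall a, Supp xi a -> monoid g (a - a0)) ->
  order_series (lex_preorder us) xi.
Proof.
move=> xint /xint[z zE] gn xg; have [m [M [gM Mn]]] := monoid_conic_hull (R := R) g.
(* Denominator [1] because the support is integral, and apex [a0]. *)
exists 1%N, z, (conic_hull (map_mx intr M)); split=> //.
- by exists m, M.
- by move=> v /(lexnn_conic_hull (Mn _ gn)) lv; apply/lex_preorderE; rewrite subr0.
- move=> a xa; split=> /=; first by rewrite scale1r; apply: xint.
  rewrite (_ : map_mx intr z = real a0); first by rewrite -real_exponentB; apply/gM/xg.
  by rewrite zE; apply/matrixP => i j; rewrite !mxE ratr_int.
Qed.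

Section MinPoly.
Variables (xi : series K n).
Hypothesis xi_alg : algebraic R xi.
Local Notation P := (@minpoly K R n xi).
Let ann : @annihilates K R n P xi := (minpolyP xi_alg).1.

Lemma minpoly_monoid i : (i < size P)%N -> forall a, Supp (nth zero_series P i) a ->
  monoid units a.
Proof.
by case: ann => -[Pi _] _ _ iP a Pa; have [ai ao] := Pi i iP a Pa; apply: orthant_monoid.
Qed.

Lemma minpoly_neq0 : exists2 i, (i < size P)%N & Supp (nth zero_series P i) !=set0.
Proof.
case: ann => -[_ lastP] P0 _; have sP : (0 < size P)%N by case: (P) P0.
exists (size P).-1; first by rewrite prednK.
apply/set0P/eqP => S0; apply: lastP; rewrite (last_nth zero_series).
case: (P) sP S0 => //= p s _ S0; apply/funext => a; apply: not_supp.
by move=> sa; have : Supp (nth zero_series (p :: s) (size s)) a by []; rewrite S0.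
Qed.

Lemma minpoly_sum c :
  \sum_(i < size P) conv (nth zero_series P i) (pow xi i) c = 0.
Proof. by case: ann => _ _ /(congr1 (fun f : series K n => f c)). Qed.

Lemma order_roots_self (le : rel V) : order_series le xi -> order_roots le xi xi.
Proof. by split=> //; case: ann. Qed.

Hypothesis charK : [pchar K] =i pred0.

(** The form in which the key fact is used, with the minimal polynomial as equation. *)
Lemma algebraic_order_series (F : support_family R G) us a0 :
  algebraic_least (K := K) F -> nn F = lexnn (wts us) ->
  positive_order (lex_preorder us) -> Supp xi `<=` integer_points ->
  least (nn F) (supp xi) a0 -> fam F [set c | supp xi (c + a0)] ->
  order_series (lex_preorder us) xi.
Proof.
move=> aleast nnE pos xint xl xF.
have [|g [gn xg]] := laurent_fg charK aleast xl xF _ minpoly_neq0 minpoly_sum.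
  move=> i iP; exists units, 0; split; first by rewrite nnE; apply: units_nonneg.
  by move=> c; rewrite subr0; apply: minpoly_monoid.
by apply: (@fg_order_series us xi a0 g) => //; [exact: xl.1 | rewrite -nnE].
Qed.

End MinPoly.

Lemma finite_integer_box (B : R) :
  finite_set [set a : G | integer_points a /\ forall j, `|real a 0 j| <= B].
Proof.
pose N := (Num.truncn B).+1.
pose f (x : {ffun 'I_n -> 'I_(N + N).+1}) : G := \row_j ((x j : nat)%:R - N%:R).
apply: (@sub_finite_set _ _ (f @` setT)); last exact/finite_image/finite_finset.
move=> a [[z ->] zB].
have zN j : `|z 0 j| <= N%:Z.
  have := zB j; rewrite !mxE ratr_int -intr_norm => /le_lt_trans/(_ (truncnS_gt B)).
  by rewrite -[_.+1%:R]/(N%:Z%:~R) ltr_int => /ltW.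
exists [ffun j => inord (absz (z ord0 j + N%:Z))] => //.
apply/matrixP => i j; rewrite (ord1 i) !mxE ffunE.
have := zN j; rewrite ler_norml => /andP[l r].
have z0 : 0 <= z 0 j + N%:Z by rewrite -lerBlDr sub0r.
rewrite inordK; last first.
  by rewrite ltnS -lez_nat gez0_abs // PoszD lerD2r.
by rewrite natr_absz ger0_norm // rmorphD /= addrK.
Qed.

Lemma dot_mul_le (m : nat) (c : 'rV[R]_m) (M : 'M[R]_(m, n)) u :
  dot (c *m M) u = \sum_i c 0 i * dot (row i M) u.
Proof.
rewrite mulmx_sum_row /dot mulmx_suml summxE; apply: eq_bigr => i _.
by rewrite -scalemxAl mxE.
Qed.

(* An integral support in a rational cone on which [u] is nonnegative meets only
   finitely many levels of [u] below a given one: subtracting integral multiples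
   of the generators of weight [0] reduces to a bounded set. *)
Lemma finite_levels us u xi C : Supp xi `<=` integer_points ->
  order_series (lex_preorder us) xi -> refines (lex_preorder us) (omega_preorder u) ->
  finite_set [set r : R | r <= C /\ exists2 a, Supp xi a & wt u a = r].
Proof.
move=> xint [k [gam [rho [_ [m [M ->]] rho_nn xrho]]]] ref.
pose MR : 'M[R]_(m, n) := map_mx intr M; pose gR : V := map_mx intr gam.
have Mu i : 0 <= dot (row i MR) u.
  apply: (refines_ge0 ref); have := rho_nn _ (conic_hull_row MR i).
  by move=> /lex_preorderE; rewrite subr0.
(* After the reduction below, a coefficient is at most [1] on a generator of weight [0] and, the
   total weight being bounded, at most the given quotient on the others; [B0] dominates all these
   bounds. *)
pose B0 := \sum_i (if dot (row i MR) u == 0 then 1 else (C - dot gR u) / dot (row i MR) u).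
pose B := \sum_j (`|gR 0 j| + \sum_i B0 * `|MR i j|).
apply: sub_finite_set (finite_image (wt u) (finite_integer_box B)) => r [rC [a xa ar]].
have [_ /= [c c0 ac]] := xrho _ xa.
have cu : \sum_i c 0 i * dot (row i MR) u <= C - dot gR u.
  by rewrite -dot_mul_le -ac dotBl lerB // -/(wt u a) ar.
have term_ge0 i : 0 <= c 0 i * dot (row i MR) u by rewrite mulr_ge0.
(* Integer parts are removed on generators of weight [0] only, so the level is unchanged and the
   exponent stays integral. *)
pose fl : 'rV[int]_m := \row_i (if dot (row i MR) u == 0 then Num.floor (c 0 i) else 0).
pose c' : 'rV[R]_m := c - map_mx intr fl.
have c'0 i : 0 <= c' 0 i.
  by rewrite !mxE; case: ifP => _; rewrite ?subr0 // subr_ge0 ge_floor.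
have cB i0 : 0 <= (if dot (row i0 MR) u == 0 then 1 else (C - dot gR u) / dot (row i0 MR) u).
  case: ifP => _; first exact: ler01.
  by rewrite divr_ge0 //; apply: le_trans cu; apply: sumr_ge0.
have c'B i : c' 0 i <= B0.
  apply: (le_trans (y := if dot (row i MR) u == 0 then 1 else (C - dot gR u) / dot (row i MR) u)).
    rewrite !mxE; case: ifPn => [_|u0].
      by rewrite lerBlDr addrC ltW // -[1]/(1%:~R) -intrD floorD1_gt.
    rewrite subr0 ler_pdivlMr; last by rewrite lt_def u0 /=.
    apply: le_trans cu; rewrite (bigD1 i) //= lerDl; exact: sumr_ge0.
  by rewrite /B0 (bigD1 i) //= lerDl sumr_ge0.
have [z zE] := xint _ xa.
pose bz := z - fl *m M.
have aE : real a = gR + c *m MR by rewrite -ac addrC subrK.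
have bR : real (map_mx intr bz) = gR + c' *m MR.
  rewrite mulmxBl addrA -aE zE -map_mxM.
  by apply/matrixP => i j; rewrite !mxE !ratr_int rmorphB.
exists (map_mx intr bz).
  split=> [|j]; first by exists bz.
  rewrite bR mxE (le_trans (ler_normD _ _)) //.
  rewrite /B (bigD1 j) //= -[X in X <= _]addr0; apply: lerD; last first.
    apply: sumr_ge0 => i _; rewrite addr_ge0 // sumr_ge0 // => i' _.
    by rewrite mulr_ge0 // (le_trans (c'0 i')).
  rewrite lerD2l mxE (le_trans (ler_norm_sum _ _ _)) //.
  by apply: ler_sum => i _; rewrite normrM (ger0_norm (c'0 i)) ler_wpM2r.
rewrite -ar /wt bR aE !dotDl !dot_mul_le; congr (_ + _); apply: eq_bigr => i _.
by rewrite !mxE; case: eqP => [->|_]; rewrite ?mulr0 // subr0.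
Qed.

End AlgebraicSeries.

(** * Infinite initial parts *)

Lemma real_group_order (R : realDomainType) : group_order [set x : R | 0 <= x].
Proof.
split=> [x y|x /= x0|x] /=; first exact: addr_ge0.
  by rewrite oppr_ge0 => x0'; apply/eqP; rewrite eq_le x0 x0'.
by rewrite oppr_ge0; case: (leP 0 x) => [|/ltW]; [left|right].
Qed.

Section InfiniteInitialPart.
Context {K : fieldType} {R : realType} {n : nat}.
Local Notation V := 'rV[R]_n.
Local Notation G := 'rV[rat]_n.
Variable xi : series K n.
Hypotheses (charK : [pchar K] =i pred0) (xi_alg : algebraic R xi)
  (xi_int : Supp xi `<=` integer_points) (xi0 : Supp xi !=set0).

(** After translation by the least exponent, the finitely many exponents below a level of [w] serve
    as generators themselves, so the support belongs to [locally_fg_family]. *)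
Lemma finite_sublevels_order_series us (w : V) :
  antisymmetric (lex_preorder us) -> positive_order (lex_preorder us) ->
  refines (lex_preorder us) (omega_preorder w) ->
  finsub (wt w) (Supp xi) -> order_series (lex_preorder us) xi.
Proof.
move=> anti pos ref fxi; have us0 := antisymmetric_vanish anti.
have go := lexnn_order us0.
have w_lexnn a : lexnn (wts us) a -> 0 <= wt w a.
  by rewrite lexnn_wts; apply: (refines_ge0 ref).
have lexnn_w := lexnn_gt0 ref.
have [s xs] := xi0.
have [|a0 [[xa0 wa0] la0]] := least_finite go (fxi (wt w s)); first by exists s; split=> /=.
have l0 : least (lexnn (wts us)) (supp xi) a0.
  split=> // b xb; have [bs|sb] := leP (wt w b) (wt w s); first exact: la0.
  by apply: lexnn_w; rewrite raddfB subr_gt0 (le_lt_trans wa0).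
apply: (@algebraic_order_series K R n xi xi_alg charK (locally_fg_family us0 w_lexnn) us a0) => //.
  exact: locally_fg_least.
have xin : [set c | supp xi (c + a0)] `<=` lexnn (wts us).
  by move=> c /l0.2; rewrite addrK.
split=> // C; have /finite_seqP[s' s'E] := finsub_shift a0 fxi C.
exists s'; split=> [x xs'|a xa].
  by have : [set` s'] x by []; rewrite -s'E => -[/xin].
by apply: monoid_mem; have : [set` s'] a by rewrite -s'E.
Qed.

Lemma infinite_initial_part (w : V) :
  (pos_orthant R n `\` (tau0 R xi `|` tau1 R xi)) w ->
  exists p : series K n,
    [/\ laurent_polynomial p,
        initial_defined w (add_series xi p) &
        infinite_set (Supp (initial_part w (add_series xi p)))].
Proof.
move=> [wpos ntau].
(* Otherwise [xi] would be a root for no order refining [w], and [w] would be in [tau1]. *)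
have [us1 [ord1 ref1]] : exists us, order_series (lex_preorder us) xi /\
    refines (lex_preorder us) (omega_preorder w).
  apply: contrapT => H; apply: ntau; right; split=> // le [[us ->] _] _ ref eta [eta_le _] E.
  by apply: H; exists us; split=> //; rewrite E.
have ninf : ~ finsub (wt w) (Supp xi).
  move=> fxi; apply: ntau; left; split=> // le [[us ->] anti] pos ref.
  exists xi => //; apply: order_roots_self => //.
  exact: finite_sublevels_order_series ref fxi.
have /existsNP[C Cinf] := ninf.
have /finite_seqP[rs rsE] := finite_levels C xi_int ord1 ref1.
have rsP r : (r \in rs) <-> (r <= C /\ exists2 a, Supp xi a & wt w a = r).
  by change ([set` rs] r <-> r <= C /\ exists2 a, Supp xi a & wt w a = r); rewrite -rsE.
pose fib r := [set a | Supp xi a /\ wt w a = r].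
have [r0 r0rs r0inf] : exists2 r, r \in rs & infinite_set (fib r).
  apply: contrapT => H; apply: Cinf.
  have fib_fin r : r \in rs -> finite_set (fib r).
    by move=> rr; apply: contrapT => fr; apply: H; exists r.
  apply: (@sub_finite_set _ _ (\bigcup_(r in [set` rs]) fib r)).
    by move=> a [xa wa]; exists (wt w a) => //; apply/rsP; split=> //; exists a.
  by apply: bigcup_finite => // r /fib_fin.
pose bad := [seq r <- rs | `[< infinite_set (fib r) >]].
(* [v] is the lowest level with infinitely many terms; one exists because finitely many levels share
   an infinite sublevel. *)
have [v [vbad vl]] : exists v, least [set x : R | 0 <= x] [set` bad] v.
  apply: (least_seq (real_group_order R) (a := r0)).
  by rewrite mem_filter r0rs andbT; apply/asboolP.
have {vbad}: v \in bad by exact: vbad.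
rewrite mem_filter => /andP[/asboolP vinf /rsP[vC _]].
have below_fin r : r < v -> finite_set (fib r).
  move=> rv; have [rr|nrr] := boolP (r \in rs).
    apply: contrapT => fr; have /vl /= : r \in bad.
      by rewrite mem_filter rr andbT; apply/asboolP.
    by rewrite subr_ge0 leNgt rv.
  rewrite (_ : fib r = set0) //; apply/seteqP; split=> // a [xa ar].
  by move/negP: nrr; apply; apply/rsP; split; [exact: ltW (lt_le_trans rv vC) | exists a].
(* Below [v] there are finitely many levels, each with finitely many terms, so [p] is a Laurent
   polynomial; adding it removes exactly these terms. *)
pose p : series K n := fun a => if wt w a < v then - xi a else 0.
have xipE : add_series xi p = fun a => if wt w a < v then 0 else xi a.
  by apply/funext => a; rewrite /add_series /p; case: ifP; rewrite ?subrr ?addr0.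
have xipS a : Supp (add_series xi p) a <-> Supp xi a /\ v <= wt w a.
  rewrite xipE /Supp /=; case: (ltP (wt w a) v) => wa; first by rewrite eqxx; split=> // -[].
  by split=> [|[]].
have [s [xs ws]] : fib v !=set0.
  by apply/set0P/eqP => fv0; apply: vinf; rewrite fv0.
have vw : weights w (add_series xi p) v by exists s => //; apply/xipS; rewrite ws.
have vlb : lbound (weights w (add_series xi p)) v.
  by move=> _ [a /xipS[_ va] <-].
have infE : inf (weights w (add_series xi p)) = v.
  apply/eqP; rewrite eq_le; apply/andP; split.
    by apply: ge_inf => //; exists v.
  by apply: lb_le_inf => //; exists v.
exists p; split.
- split=> [a|].
    by rewrite /Supp /= /p; case: ifP => _; rewrite ?eqxx // oppr_eq0; apply: xi_int.
  apply: (@sub_finite_set _ _ (\bigcup_(r in [set` rs] `&` [set r | r < v]) fib r)).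
    move=> a; rewrite /Supp /= /p; case: ifP => [wa|_]; rewrite ?eqxx // oppr_eq0 => xa.
    exists (wt w a) => //; split=> //; apply/rsP; split; last by exists a.
    exact: ltW (lt_le_trans wa vC).
  apply: bigcup_finite => [|r [_ /below_fin //]].
  exact: finite_setIl.
- by exists v.
- apply: sub_infinite_set vinf => a [xa wa].
  rewrite /Supp /= /initial_part infE -/(wt w a) wa eqxx xipE wa ltxx.
  exact: xa.
Qed.

End InfiniteInitialPart.

(** * A boundary weight *)

Section Gordan.
Context {R : realType} {n : nat}.
Local Notation V := 'rV[R]_n.
Implicit Types (v w h : V) (gs : seq V).

Fixpoint cone gs : set V :=
  if gs is h :: gs' then [set v | exists2 k, 0 <= k & cone gs' (v - k *: h)] else [set 0].

Lemma cone0 gs : cone gs 0.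
Proof. by elim: gs => //= h gs IH; exists 0; rewrite // scale0r subr0. Qed.

Lemma coneD gs v w : cone gs v -> cone gs w -> cone gs (v + w).
Proof.
elim: gs v w => [|h gs IH] v w /= => [-> ->|[k k0 kv] [l l0 lw]]; first by rewrite addr0.
by exists (k + l); [apply: addr_ge0 | rewrite scalerDl opprD addrACA; apply: IH].
Qed.

Lemma coneZ gs v k : 0 <= k -> cone gs v -> cone gs (k *: v).
Proof.
move=> k0; elim: gs v => [|h gs IH] v /= => [->|[l l0 lv]]; first by rewrite scaler0.
exists (k * l); first exact: mulr_ge0.
by rewrite -scalerA -scalerBr; apply: IH.
Qed.

Lemma cone_cons gs h v : cone gs v -> cone (h :: gs) v.
Proof. by move=> gv; exists 0; rewrite // scale0r subr0. Qed.

Lemma cone_mem gs h : h \in gs -> cone gs h.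
Proof.
elim: gs => //= h' gs IH; rewrite inE => /predU1P[<-|/IH]; last exact: cone_cons.
by exists 1; rewrite ?ler01 // scale1r subrr; apply: cone0.
Qed.

Lemma cone_min gs (S : set V) : S 0 -> (forall v w, S v -> S w -> S (v + w)) ->
  (forall k v, 0 <= k -> S v -> S (k *: v)) -> (forall h, h \in gs -> S h) ->
  cone gs `<=` S.
Proof.
move=> S0 SD SZ; elim: gs => [|h gs IH] gS v /=; first by move->.
case=> k k0 /IH Sv; rewrite -(subrK (k *: h) v); apply: (SD).
  by apply: Sv => w wg; apply: gS; rewrite inE wg orbT.
by apply: (SZ) => //; apply: gS; rewrite inE eqxx.
Qed.

Lemma small_positive (I : eqType) (s : seq I) (X Y : I -> R) :
  (forall i, i \in s -> 0 < X i) ->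
  exists2 e : R, 0 < e & forall i, i \in s -> 0 < X i + e * Y i.
Proof.
move=> Xs; suff [e e0 eP] : exists2 e : R, 0 < e & forall t, 0 < t < e ->
    forall i, i \in s -> 0 < X i + t * Y i.
  exists (e / 2); first by rewrite divr_gt0.
  by apply: eP; rewrite divr_gt0 //= ltr_pdivrMr // ltr_pMr // ltr1n.
elim: s Xs => [|i s IH] Xs; first by exists 1.
have [|e e0 eP] := IH; first by move=> j js; apply: Xs; rewrite inE js orbT.
have Xi : 0 < X i by apply: Xs; rewrite mem_head.
have Y0 : 0 < `|Y i| + 1 by rewrite ltr_wpDl.
exists (Num.min e (X i / (`|Y i| + 1))); first by rewrite lt_min e0 divr_gt0.
move=> t /andP[t0]; rewrite lt_min => /andP[te]; rewrite ltr_pdivlMr // => tX j.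
rewrite inE => /predU1P[->|js]; last by apply: eP; rewrite ?t0.
have := ler_norm (- Y i); rewrite normrN => Yi.
have tY : t * - Y i <= t * `|Y i| by rewrite ler_pM2l.
lra.
Qed.

Lemma dot_gt0 h : h != 0 -> 0 < dot h h.
Proof.
move=> h0; have [j hj] : exists j, h 0 j != 0.
  apply: contrapT => H; move/eqP: h0; apply; apply/matrixP => i j.
  by rewrite (ord1 i) mxE; apply/eqP; apply: contrapT => /negP hj; apply: H; exists j.
rewrite dotE (bigD1 j) //= ltr_wpDr //; last by rewrite -expr2 exprn_even_gt0.
by apply: sumr_ge0 => i _; rewrite -expr2 sqr_ge0.
Qed.

(** Induction on the number of vectors, with [w] positive on all but the first, [g]. If [g] is
    orthogonal to [w], tilting [w] towards [g] suffices. If its product with [w] is negative, the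
    other vectors are projected along [g] onto the hyperplane orthogonal to [w], and the alternative
    for the projections is lifted. *)
Lemma gordan gs : (exists w, forall h, h \in gs -> 0 < dot h w) \/
  exists2 h, h \in gs & cone gs (- h).
Proof.
have [m] := ubnP (size gs); elim: m gs => // m IH [_|g gs sm]; first by left; exists 0.
have {}sm : (size gs < m)%N by [].
 case: (IH gs sm) => [[w wP]|[h hg hN]]; last first.
  by right; exists h; [rewrite inE hg orbT | apply: cone_cons].
have [g0|g0] := eqVneq g 0.
  by right; exists g; [rewrite mem_head | rewrite g0 oppr0; apply: cone0].
case: (ltgtP (dot g w) 0) => gw.
- pose s h := - (dot h w / dot g w).
  have s0 h : h \in gs -> 0 < s h.
    by move=> /wP hw; rewrite /s oppr_gt0 pmulr_rlt0 // invr_lt0.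
  have gsub : cone [seq h + s h *: g | h <- gs] `<=` cone (g :: gs).
    apply: cone_min; [exact: cone0 | exact: coneD | by move=> k v; apply: coneZ |].
    move=> _ /mapP[h hg ->]; apply: coneD; first by apply/cone_cons/cone_mem.
    by apply: coneZ; [apply/ltW/s0 | apply: cone_mem; rewrite mem_head].
  have [|[w' w'P]|[_ /mapP[h hg ->] /gsub hN]] := IH [seq h + s h *: g | h <- gs].
  + by rewrite size_map.
  + have [e e0 eP] := @small_positive _ gs (fun h => dot (h + s h *: g) w') (fun h => - s h)
      (fun h hg => w'P _ (map_f (fun h => h + s h *: g) hg)).
    (* The multiple of [w] makes the product with [g] equal to [e]; the products of [w] with the
       projected vectors are zero. *)
    left; exists (w' + ((e - dot g w') / dot g w) *: w) => h.
    have gw0 : dot g w != 0 by rewrite lt_eqF.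
    rewrite inE dotDr dotZr => /predU1P[->|/eP].
      by rewrite mulfVK // addrC subrK.
    rewrite dotDl dotZl /s; set x := dot h w; set y := dot g w'.
    suff -> : dot h w' + (e - y) / dot g w * x =
      dot h w' + - (x / dot g w) * y + e * - - (x / dot g w) by [].
    by field.
  + right; exists h; first by rewrite inE hg orbT.
    rewrite -[- h](addrK (- (s h *: g))) opprK -opprD; apply: coneD => //.
    by apply: coneZ; [apply/ltW/s0 | apply: cone_mem; rewrite mem_head].
- by left; exists w => h; rewrite inE => /predU1P[->|/wP].
- have [e e0 eP] := @small_positive _ gs (dot^~ w) (dot^~ g) wP.
  left; exists (w + e *: g) => h; rewrite inE dotDr dotZr => /predU1P[->|/eP //].
  by rewrite gw add0r mulr_gt0 // dot_gt0.
Qed.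

(** In the other case of [gordan], the cone would contain the line spanned by a nonzero
    generator. *)
Lemma strongly_convex_positive m (M : 'M[R]_(m, n)) :
  strongly_convex (conic_hull M) ->
  exists w, forall i, row i M != 0 -> 0 < dot (row i M) w.
Proof.
move=> sc; pose gs := [seq row i M | i <- enum 'I_m & row i M != 0].
have gsM : cone gs `<=` conic_hull M.
  apply: cone_min; [exact: conic_hull0 | exact: conic_hullD | by move=> k v; apply: conic_hullZ |].
  by move=> _ /mapP[i _ ->]; apply: conic_hull_row.
case: (gordan gs) => [[w wP]|[h hg /gsM hN]].
  by exists w => i i0; apply: wP; apply: map_f; rewrite mem_filter i0 mem_enum.
move: (hg) => /cone_mem/gsM hP.
have /sc V0 : [set` <[h]>%VS] `<=` conic_hull M.
  move=> v /vlineP[k ->]; have [k0|/ltW k0] := leP 0 k; first exact: conic_hullZ.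
  by rewrite -[k](opprK) scaleNr -scalerN; apply: conic_hullZ; rewrite ?oppr_ge0.
have := memv_line h; rewrite V0 memv0 => /eqP h0.
by move: hg => /mapP[i]; rewrite mem_filter => /andP[/negP i0 _] hE; case: i0; rewrite -hE h0.
Qed.

End Gordan.

(** * Orders refining a positive weight *)

Section LexOrders.
Context {R : realType} {n : nat}.
Local Notation V := 'rV[R]_n.
Implicit Types (u v w : V) (us : seq V).

Definition basis : seq V := [seq delta_mx 0 j | j <- enum 'I_n].

Lemma vanish_mem us v : vanish (wtvs us) v -> forall u, u \in us -> dot v u = 0.
Proof.
elim: us => //= u us IH [vu /IH vus] u'; rewrite inE => /predU1P[->//|].
exact: vus.
Qed.

Lemma antisymmetric_lex us : {subset basis <= us} -> antisymmetric (lex_preorder us).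
Proof.
move=> bus v w /andP[/lex_preorderE vw /lex_preorderE wv].
apply/matrixP => i j; rewrite (ord1 i); apply/eqP; rewrite eq_sym -subr_eq0.
have vwN : lexnn (wtvs us) (- (w - v)) by rewrite opprB.
have /vanish_mem/(_ (delta_mx 0 j)) := lexnn_vanish vw vwN.
by rewrite dot_delta !mxE => ->; rewrite // bus // map_f // mem_enum.
Qed.

(** A vector of the orthant on which [w] vanishes is zero, so the first weight already decides. *)
Lemma positive_lex w us : pos_orthant R n w -> positive_order (lex_preorder (w :: us)).
Proof.
move=> w0 v v0; apply/lex_preorderE; rewrite subr0.
have vw j : 0 <= v 0 j * w 0 j by rewrite mulr_ge0 ?v0 // ltW ?w0.
have : 0 <= dot v w by rewrite dotE sumr_ge0.
rewrite le_eqVlt => /predU1P[/esym|]; last by left.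
rewrite dotE => /psumr_eq0P v00; rewrite (_ : v = 0); first exact/vanish_lexnn/vanish0.
apply/matrixP => i j; rewrite (ord1 i) mxE; have /eqP := v00 (fun j _ => vw j) j isT.
by rewrite mulf_eq0 [w 0 j == 0]gt_eqF ?w0 // orbF => /eqP.
Qed.

Lemma refines_lex w us : refines (lex_preorder (w :: us)) (omega_preorder w).
Proof.
move=> a b /lex_preorderE /= H; rewrite omega_preorderE -subr_ge0 -dotBl.
by case: H => [/ltW //|[H _]]; rewrite [dot _ _]H.
Qed.

Lemma perturb_le us t (a : 'rV[rat]_n) : 0 < t -> t < 1 ->
  `|perturb (wts us) t a| <= \sum_(u <- us) `|wt u a|.
Proof.
move=> t0 t1; elim: us => [|u us IH] /=; first by rewrite normr0 big_nil.
rewrite big_cons (le_trans (ler_normD _ _)) // lerD2l normrM (gtr0_norm t0).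
by rewrite (le_trans _ IH) // ler_piMl // ltW.
Qed.

End LexOrders.

(** * Interior weights and uniform lower bounds *)

Section Boundary.
Context {K : fieldType} {R : realType} {n : nat}.
Local Notation V := 'rV[R]_n.
Local Notation G := 'rV[rat]_n.
Local Notation real a := (real_exponent (R := R) a).
Implicit Types (u v w : V) (us : seq V) (a b c : G).

Definition l1norm v : R := \sum_j `|v 0 j|.

Lemma l1norm_ge0 v : 0 <= l1norm v.
Proof. by apply: sumr_ge0. Qed.

Lemma coord_le_l1norm v j : `|v 0 j| <= l1norm v.
Proof. by rewrite /l1norm (bigD1 j) //= lerDl sumr_ge0. Qed.

Lemma l1normD u v : l1norm (u + v) <= l1norm u + l1norm v.
Proof.
rewrite /l1norm -big_split; apply: ler_sum => j _; rewrite mxE; exact: ler_normD.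
Qed.

Lemma dot_le_l1norm u v : `|dot u v| <= l1norm v * l1norm u.
Proof.
rewrite dotE (le_trans (ler_norm_sum _ _ _)) // mulr_sumr; apply: ler_sum => j _.
by rewrite normrM mulrC ler_wpM2r // coord_le_l1norm.
Qed.

Lemma sum_basis_norm a : \sum_(u <- basis) `|wt u a| = l1norm (real a).
Proof.
rewrite /basis big_map big_enum; apply: eq_bigr => j _; by rewrite /wt dot_delta.
Qed.

Variable xi : series K n.
Hypothesis xi_int : Supp xi `<=` integer_points.

(* [w] lies in the interior of the dual of some cone a translate of which
   contains the support of [xi]. *)
Definition interior_weight w := exists2 C, 0 <= C &
  exists D, forall a, Supp xi a -> l1norm (real a) <= C * wt w a + D.

Lemma finite_l1norm_le S (B : R) : S `<=` Supp xi ->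
  (forall a, S a -> l1norm (real a) <= B) -> finite_set S.
Proof.
move=> Sxi SB; apply: sub_finite_set (finite_integer_box B) => a Sa; split.
  exact/xi_int/Sxi.
by move=> j; apply: le_trans (coord_le_l1norm _ _) (SB _ Sa).
Qed.

Lemma interior_weight_finsub w : interior_weight w -> finsub (wt w) (Supp xi).
Proof.
move=> [C C0 [D CD]] M; apply: (@finite_l1norm_le _ (C * M + D)) => [a []//|].
by move=> a [/CD + /= wM] => /le_trans; apply; rewrite lerD2r ler_wpM2l.
Qed.

(** On a generator of the cone, either [w] is positive and a multiple of it dominates [- u], or [w]
    vanishes and [u] is nonnegative. Nonnegative combinations preserve the resulting inequality. *)
Lemma order_series_bound w u us : order_series (lex_preorder [:: w, u & us]) xi ->
  exists2 C, 0 <= C & exists D, forall a, Supp xi a -> - wt u a <= C * wt w a + D.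
Proof.
move=> [k [gam [rho [_ [m [M ->]] rho_nn xrho]]]].
pose MR : 'M[R]_(m, n) := map_mx intr M; pose gR : V := map_mx intr gam.
have Mlex i : 0 < dot (row i MR) w \/ dot (row i MR) w = 0 /\ 0 <= dot (row i MR) u.
  have := rho_nn _ (conic_hull_row MR i) => /lex_preorderE; rewrite subr0 /=.
  by case=> [|[w0 [/ltW|[u0 _]]]]; [left|right|right; rewrite [dot _ u]u0].
have Mw i : 0 <= dot (row i MR) w by case: (Mlex i) => [/ltW|[->]].
pose Ci i := `|dot (row i MR) u| / dot (row i MR) w.
have Ci0 i : 0 <= Ci i by rewrite divr_ge0.
exists (\sum_i Ci i); first exact: sumr_ge0.
exists (- (\sum_i Ci i) * dot gR w - dot gR u) => a /xrho[_ /= [c c0 ac]].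
have aE : real a = gR + c *m MR by rewrite -ac addrC subrK.
rewrite /wt aE !dotDl !dot_mul_le.
suff H : - (\sum_i c 0 i * dot (row i MR) u) <=
    (\sum_i Ci i) * \sum_i c 0 i * dot (row i MR) w by lra.
rewrite -sumrN mulr_sumr; apply: ler_sum => i _; rewrite -mulrN mulrCA ler_wpM2l //.
case: (Mlex i) => [w0|[w0 u0]]; last by rewrite w0 mulr0 oppr_le0.
apply: (le_trans (y := Ci i * dot (row i MR) w)).
  by rewrite /Ci divfK ?gt_eqF // -normrN ler_norm.
by rewrite ler_wpM2r // (bigD1 i) //= lerDl sumr_ge0.
Qed.

Lemma tau0_interior_weight w : tau0 R xi w -> interior_weight w.
Proof.
move=> [w0 wtau].
have bound u : exists2 C, 0 <= C & exists D, forall a, Supp xi a -> - wt u a <= C * wt w a + D.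
  apply: (@order_series_bound w u basis).
  have [|||eta [eta_le _] ->] := wtau (lex_preorder [:: w, u & basis]); last exact: eta_le.
  - split; first by exists [:: w, u & basis].
    by apply: antisymmetric_lex => v vb; rewrite !inE vb !orbT.
  - exact: positive_lex.
  - exact: refines_lex.
(* With [u = w] the bound says that [w] is bounded below on the support; bounds with different
   constants can then be added. *)
have [C0 C00 [D0 CD0]] := bound w.
have wB a : Supp xi a -> 0 <= wt w a + `|D0|.
  move=> /CD0 H; have := ler_norm D0; have := normr_ge0 D0.
  have [|wa] := leP 0 (wt w a); first lra.
  by have := mulr_ge0 C00 (ltW (etrans (oppr_gt0 _) wa)); rewrite mulrN; lra.
have /choice[CD CDP] j : exists CD : R * R, 0 <= CD.1 /\
    forall a, Supp xi a -> `|real a 0 j| <= CD.1 * wt w a + CD.2.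
  have [C C_ge0 [D CD]] := bound (delta_mx 0 j).
  have [C' C'_ge0 [D' CD']] := bound (- delta_mx 0 j).
  exists (C + C', `|D| + `|D'| + (C + C') * `|D0|) => /=; split; first exact: addr_ge0.
  move=> a xa; have := mulr_ge0 C_ge0 (wB _ xa); have := mulr_ge0 C'_ge0 (wB _ xa).
  have := CD _ xa; have := CD' _ xa;
  rewrite -[- delta_mx 0 j]scaleN1r /wt dotZr mulN1r opprK dot_delta.
  have := ler_norm D; have := ler_norm D'; have := normr_ge0 D; have := normr_ge0 D'.
  have := mulr_ge0 C_ge0 (normr_ge0 D0); have := mulr_ge0 C'_ge0 (normr_ge0 D0).
  by rewrite ler_norml => *; apply/andP; split; lra.
exists (\sum_j (CD j).1); first by apply: sumr_ge0 => j _; case: (CDP j).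
exists (\sum_j (CD j).2) => a xa; rewrite mulr_suml -big_split; apply: ler_sum => j _.
by case: (CDP j) => _ /(_ a xa).
Qed.

(** The list [s] is independent of [w]: it takes one exponent from each nonzero coefficient of the
    minimal polynomial, and [0] for the others. For the least exponent [al] of [xi], Newton's
    polygon gives [(j - i) al = bi - bj], where [bi] has nonnegative weight and [bj] weighs no more
    than the chosen exponent of its coefficient. *)
Lemma minpoly_weight_bound (xi_alg : algebraic R xi) : exists s : seq G,
  forall w, pos_orthant R n w -> finsub (wt w) (Supp xi) ->
  forall a, Supp xi a -> - (\sum_(b <- s) `|wt w b|) <= wt w a.
Proof.
pose P := @minpoly K R n xi.
have /choice[pt ptP] i : exists b : G, Supp (nth zero_series P i) !=set0 ->
    Supp (nth zero_series P i) b.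
  have [[b Pb]|H] := pselect (Supp (nth zero_series P i) !=set0); first by exists b.
  by exists 0.
exists [seq pt i | i <- iota 0 (size P)] => w w0 fw a xa.
have go : group_order (lexnn (wts (w :: basis))).
  apply/lexnn_order/antisymmetric_vanish/antisymmetric_lex => v vb.
  by rewrite inE vb orbT.
have pos : positive_order (lex_preorder (w :: basis)) by apply: positive_lex.
have [|al [xal lal]] := least_finsub go fw; first by exists a.
have [|i [j [bi [bj [/andP[ij jP] [Pbi _] [Pbj lbj] E]]]]] := newton go (conj xal lal) _
    (minpoly_neq0 xi_alg) (minpoly_sum xi_alg).
  move=> i iP Pi; apply: (least_monoid go (a0 := 0) (g := units)) => //.
    exact: units_nonneg.
  by move=> b; rewrite subr0; apply: minpoly_monoid.
have wal : wt w al <= wt w a.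
  by have := lal _ xa; rewrite /= raddfB -subr_ge0 => -[/ltW|[->]].
apply: le_trans wal; have wbi : 0 <= wt w bi.
  have := units_nonneg pos; have := minpoly_monoid xi_alg (ltn_trans ij jP) Pbi => ub un.
  by have := nn_monoid go un ub => /= -[/ltW|[->]].
have wbj : wt w bj <= \sum_(b <- [seq pt i | i <- iota 0 (size P)]) `|wt w b|.
  have Ptj := ptP j (ex_intro _ _ Pbj).
  apply: (le_trans (y := wt w (pt j))).
    by have := lbj _ Ptj; rewrite /= raddfB -subr_ge0 => -[/ltW|[->]].
  apply: (le_trans (ler_norm _)); rewrite big_map (big_rem j) ?mem_iota //=.
  by rewrite lerDl sumr_ge0.
have := congr1 (wt w) E; rewrite !raddfD !raddfMn -(subnK (ltnW ij)) mulrnDr /=.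
have [al0|al0] := leP 0 (wt w al).
  by move=> _; apply: le_trans al0; rewrite oppr_le0 sumr_ge0.
have : wt w al *+ (j - i) <= wt w al.
  rewrite -subn_gt0 in ij; case: (j - i)%N ij => // k _.
  by rewrite mulrS gerDl mulrn_wle0 // ltW.
lra.
Qed.

End Boundary.

Section BoundaryPoint.
Context {K : fieldType} {R : realType} {n : nat}.
Local Notation V := 'rV[R]_n.
Local Notation G := 'rV[rat]_n.
Local Notation real a := (real_exponent (R := R) a).
Implicit Types (u v w : V) (a b c : G).
Variable xi : series K n.
Hypotheses (xi_int : Supp xi `<=` integer_points) (xi_alg : algebraic R xi).

(** A weight that is positive on the nonzero generators dominates the norm on the whole cone; it is
    then positive on the basis vectors, which lie in the cone and have norm [1]. *)
Lemma cone_interior_weight (sigma : set V) : rational_cone sigma ->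
  strongly_convex sigma -> orthant R n `<=` sigma -> cone_series_loc sigma xi ->
  exists w, pos_orthant R n w /\ exists2 C, 0 < C &
    exists D, forall a, Supp xi a -> l1norm (real a) <= C * wt w a + D.
Proof.
move=> [m [M ->]]; set MR : 'M[R]_(m, n) := map_mx intr M => sc orth [gam xis].
have [w wP] := strongly_convex_positive sc.
have w_ge0 i : 0 <= dot (row i MR) w.
  by have [->|/wP/ltW//] := eqVneq (row i MR) 0; rewrite /dot mul0mx mxE.
pose Ci i := l1norm (row i MR) / dot (row i MR) w.
have Ci0 i : 0 <= Ci i by rewrite divr_ge0 // l1norm_ge0.
pose C := \sum_i Ci i.
have C0 : 0 <= C by apply: sumr_ge0.
have coneP v : conic_hull MR v -> 0 <= dot v w /\ l1norm v <= C * dot v w.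
  move=> [c c0 ->]; rewrite dot_mul_le; split.
    by apply: sumr_ge0 => i _; rewrite mulr_ge0.
  apply: (le_trans (y := \sum_i c 0 i * l1norm (row i MR))).
    rewrite mulmx_sum_row; elim/big_rec2: _ => [|i x y _ xy].
      by rewrite /l1norm big1 // => j _; rewrite mxE normr0.
    rewrite (le_trans (l1normD _ _)) // lerD // /l1norm mulr_sumr.
    by apply: ler_sum => j _; rewrite mxE normrM ger0_norm.
  rewrite mulr_sumr; apply: ler_sum => i _; rewrite mulrCA ler_wpM2l //.
  apply: (le_trans (y := Ci i * dot (row i MR) w)); last first.
    by rewrite ler_wpM2r // /C (bigD1 i) //= lerDl sumr_ge0.
  have [->|/wP w0] := eqVneq (row i MR) 0; last by rewrite divfK ?gt_eqF.
  by rewrite /dot mul0mx mxE mulr0 /l1norm big1 // => j _; rewrite mxE normr0.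
exists w; split.
  move=> j; have /coneP[] : conic_hull MR (delta_mx 0 j).
    by apply: orth => i; rewrite mxE ler0n.
  rewrite dotC dot_delta => w0 wj; rewrite lt_def w0 andbT; apply/eqP => wj0.
  have := le_trans (coord_le_l1norm (delta_mx 0 j) j) wj.
  by rewrite wj0 mulr0 mxE !eqxx normr1 ler10.
pose gR : V := map_mx intr gam.
exists (C + 1); first by rewrite ltr_wpDl.
exists (l1norm gR - (C + 1) * dot gR w) => a /xis[_ /= /coneP[]].
rewrite dotBl -/gR -/(wt w a) => vw vC.
have := l1normD (real a - gR) gR; rewrite subrK; lra.
Qed.

(** [t] is the supremum of the parameters at which the segment from [w0] to [e] is interior. The
    lower bound [- B] is uniform over [A] and passes to the limit, so [t < 1] because [e] is
    unbounded below. Interiority is an open condition along the segment, hence fails at [t]. *)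
Lemma boundary_weight w0 e : pos_orthant R n w0 -> interior_weight xi w0 ->
  orthant R n e -> (forall N : R, exists2 a, Supp xi a & wt e a < N) ->
  exists w, [/\ pos_orthant R n w, ~ interior_weight xi w &
    exists B, forall a, Supp xi a -> - B <= wt w a].
Proof.
move=> w0_pos w0_int e_ge0 e_unb.
pose om s : V := w0 + s *: (e - w0).
have wtom s a : wt (om s) a = wt w0 a + s * wt (e - w0) a by rewrite /wt /om dotDr dotZr.
have wte a : wt e a = wt w0 a + wt (e - w0) a by rewrite /wt -dotDr addrC subrK.
have om_pos s : 0 <= s -> s < 1 -> pos_orthant R n (om s).
  move=> s0 s1 j; rewrite !mxE; have := w0_pos j; have := e_ge0 j => ej wj.
  have -> : w0 0 j + s * (e 0 j - w0 0 j) = (1 - s) * w0 0 j + s * e 0 j by ring.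
  by rewrite ltr_wpDr ?mulr_ge0 // mulr_gt0 // subr_gt0.
pose A := [set s : R | [/\ 0 <= s, s < 1 & interior_weight xi (om s)]].
have A0 : A 0 by split; rewrite ?ltr01 // /om scale0r addr0.
have Aub : ubound A 1 by move=> s [_ /ltW].
have Asup : has_sup A by split; [exists 0 | exists 1].
have [s sB] := minpoly_weight_bound xi_alg.
pose B := \sum_(b <- s) (`|wt w0 b| + `|wt (e - w0) b|).
have bound t : A t -> forall a, Supp xi a -> - B <= wt (om t) a.
  move=> [t0 t1 tint] a xa.
  apply: le_trans (sB _ (om_pos t t0 t1) (interior_weight_finsub xi_int tint) a xa).
  rewrite lerN2; apply: ler_sum => b _; rewrite wtom (le_trans (ler_normD _ _)) //.
  by rewrite lerD2l normrM ger0_norm // ler_piMl // ltW.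
pose t := sup A.
have t_ge0 : 0 <= t by apply: ub_le_sup A0; exists 1.
have t_le1 : t <= 1 by apply: ge_sup => //; exists 0.
have tbound a : Supp xi a -> - B <= wt (om t) a.
  move=> xa; rewrite leNgt; apply/negP => tB; set q := wt (e - w0) a.
  have q0 : 0 < `|q| + 1 by rewrite ltr_wpDl.
  have eps0 : 0 < (- B - wt (om t) a) / (`|q| + 1) by rewrite divr_gt0 // subr_gt0.
  have [r Ar rt] := sup_adherent eps0 Asup.
  have rt' : r <= t by apply: ub_le_sup Ar; exists 1.
  have := bound r Ar a xa; move: rt; rewrite -/t ltrBlDr -ltrBlDl ltr_pdivlMr //.
  rewrite !wtom -/q => rt Br.
  have := ler_norm (- q); rewrite normrN => qn.
  have : (t - r) * - q <= (t - r) * `|q| by rewrite ler_wpM2l // subr_ge0.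
  lra.
have t_lt1 : t < 1.
  rewrite lt_neqAle t_le1 andbT; apply/eqP => t1.
  have [a xa aB] := e_unb (- B); have := tbound a xa.
  by rewrite t1 wtom mul1r -wte leNgt aB.
exists (om t); split; [exact: om_pos | | by exists B].
move=> [C C0 [D CD]]; pose Q := l1norm (e - w0).
have Q0 : 0 <= Q by apply: l1norm_ge0.
have CQ0 : 0 <= C * Q by rewrite mulr_ge0.
(* Small enough that [t + dl < 1] and [dl * C * Q <= 1 / 2]: moving by [dl] costs at most half of
   the norm, whence the constants [2 * C] and [2 * D]. *)
pose dl := Num.min ((1 - t) / 2) (1 / (2 * (C * Q + 1))).
have CQ1 : 0 < 2 * (C * Q + 1) by lra.
have dl0 : 0 < dl by rewrite lt_min !divr_gt0 ?subr_gt0.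
have dl1 : dl <= (1 - t) / 2 by rewrite ge_min lexx.
have dl2 : dl * (2 * (C * Q + 1)) <= 1 by rewrite -ler_pdivlMr // ge_min lexx orbT.
have At : A (t + dl).
  split; [exact: addr_ge0 (ltW dl0) | by lra |].
  exists (2 * C); first by rewrite mulr_ge0.
  exists (2 * D) => a xa; have := CD a xa; rewrite !wtom; set q := wt (e - w0) a; set N := l1norm _.
  have N0 : 0 <= N by apply: l1norm_ge0.
  have qN : - q <= Q * N by rewrite (le_trans (ler_norm _)) // normrN; apply: dot_le_l1norm.
  have : C * dl * - q <= C * dl * (Q * N) by rewrite ler_wpM2l // mulr_ge0 // ltW.
  have : dl * (2 * (C * Q + 1)) * N <= 1 * N by rewrite ler_wpM2r.
  have : 0 <= dl * N by rewrite mulr_ge0 // ltW.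
  lra.
have : t + dl <= t by apply: ub_le_sup At; exists 1.
by rewrite gerDl leNgt dl0.
Qed.

Hypothesis charK : [pchar K] =i pred0.

(** The key fact is applied in [germ_family] to the order [(w, w0, e_1, ..., e_n)]: as [w] is
    bounded below, a small multiple of [w0] makes the sublevels of the perturbed weight finite. *)
Lemma boundary_not_tau1 w0 w C0 D0 B : 0 < C0 ->
  (forall a, Supp xi a -> l1norm (real a) <= C0 * wt w0 a + D0) ->
  pos_orthant R n w -> (forall a, Supp xi a -> - B <= wt w a) ->
  Supp xi !=set0 -> ~ tau1 R xi w.
Proof.
move=> C0_gt0 w0P wpos wB xi0 [_ wtau].
pose us : seq V := [:: w, w0 & basis].
have anti : antisymmetric (lex_preorder us).
  by apply: antisymmetric_lex => v vb; rewrite !inE vb !orbT.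
have pos : positive_order (lex_preorder us) by apply: positive_lex.
have us0 := antisymmetric_vanish anti.
suff xi_us : order_series (lex_preorder us) xi.
  apply: (wtau (lex_preorder us) _ pos (@refines_lex _ _ w _) xi) => //.
    by split=> //; exists us.
  exact: order_roots_self.
have germ : exists2 e : R, 0 < e & forall t, 0 < t < e -> finsub (perturb (wts us) t) (supp xi).
  (* For [t < 1 / (2 C0)] the basis terms, at most [t^2 N] for an exponent of norm [N], cost at most
     half of the gain [t N / C0] due to [w0]. *)
  exists (Num.min 1 (1 / (2 * C0))); first by rewrite lt_min ltr01 divr_gt0 // mulr_gt0.
  move=> t /andP[t0]; rewrite lt_min => /andP[t1]; rewrite ltr_pdivlMr ?mulr_gt0 // => tC X.
  apply: (@finite_l1norm_le K R n xi xi_int _ (2 * (C0 * (X + B) + t * D0) / t)) => [a []//|].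
  move=> a [xa /=]; have := perturb_le (basis : seq V) a t0 t1; rewrite sum_basis_norm.
  set p := perturb _ _ a; rewrite ler_norml => /andP[pN _] aX.
  have := w0P a xa; have := wB a xa; move: aX pN; set N := l1norm _ => aX pN aB aN.
  have N0 : 0 <= N by apply: l1norm_ge0.
  rewrite ler_pdivlMr //.
  have h1 : t * N <= t * (C0 * wt w0 a + D0) by rewrite ler_pM2l.
  have h2 : C0 * (wt w a + t * (wt w0 a + t * p)) <= C0 * X by rewrite ler_pM2l.
  have h3 : C0 * - B <= C0 * wt w a by rewrite ler_pM2l.
  have h4 : C0 * t * t * - N <= C0 * t * t * p by rewrite ler_pM2l // !mulr_gt0.
  have h5 : t * (2 * C0) * (t * N) <= 1 * (t * N).
    by apply: ler_wpM2r; [rewrite mulr_ge0 // ltW | exact: ltW].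
  lra.
have [|a al] := algebraic_germ_least us0 germ xi0 _ (minpoly_neq0 xi_alg) (minpoly_sum xi_alg).
  move=> i iP; exists units, 0; split; first exact: units_nonneg.
  by move=> a; rewrite subr0; apply: minpoly_monoid.
apply: (@algebraic_order_series K R n xi xi_alg charK (germ_family us0) us a) => //.
  exact: germ_algebraic_least.
split; first by move=> c /al.2; rewrite addrK.
by have [e e0 eP] := germ; exists e => // t /eP; apply: finsub_shift.
Qed.

End BoundaryPoint.

Theorem theorem5p13 (K : fieldType) (charK : [pchar K] =i pred0)
    (R : realType) (n : nat) (sigma : set 'rV[R]_n)
    (sigma_rational : rational_cone sigma)
    (sigma_convex : strongly_convex sigma)
    (sigma_orthant : orthant R n `<=` sigma)
    (xi : series K n)
    (xi_sigma : cone_series_loc sigma xi)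
    (xi_not_power : ~ cone_series_loc (orthant R n) xi)
    (xi_algebraic : algebraic R xi) :
  pos_orthant R n `\` (tau0 R xi `|` tau1 R xi) !=set0 /\
  forall omega : 'rV[R]_n,
    (pos_orthant R n `\` (tau0 R xi `|` tau1 R xi)) omega ->
    exists p : series K n,
      [/\ laurent_polynomial p,
          initial_defined omega (add_series xi p) &
          infinite_set (Supp (initial_part omega (add_series xi p)))].
Proof.
have xi_int : Supp xi `<=` integer_points by case: xi_sigma => gam H a /H[].
(* If every coordinate were bounded below on the support, the integer parts of the bounds would be
   the apex of a translated orthant containing it, against [xi_not_power]. *)
have [j j_unb] : exists j, forall N : R, exists2 a, Supp xi a & wt (delta_mx 0 j) a < N.
  apply: contrapT => H; apply: xi_not_power.
  have /choice[lo loP] j : exists N : R, forall a, Supp xi a -> N <= wt (delta_mx 0 j) a.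
    apply: contrapT => Hj; apply: H; exists j => N; apply: contrapT => HN; apply: Hj.
    by exists N => a xa; rewrite leNgt; apply/negP => aN; apply: HN; exists a.
  exists (\row_j Num.floor (lo j)) => a xa; split; first exact: xi_int.
  move=> j; rewrite !mxE subr_ge0; apply: le_trans (ge_floor _) _.
  by have := loP j a xa; rewrite /wt dot_delta mxE.
have xi0 : Supp xi !=set0 by have [a xa _] := j_unb 0; exists a.
split; last by move=> w; apply: infinite_initial_part.
have [w0 [w0_pos [C C0 [D CD]]]] :=
  cone_interior_weight sigma_rational sigma_convex sigma_orthant xi_sigma.
have w0_int : interior_weight xi w0 by exists C; [exact: ltW | exists D].
have e_ge0 : orthant R n (delta_mx 0 j) by move=> i; rewrite mxE ler0n.
have [w [w_pos w_nint [B wB]]] := boundary_weight xi_int xi_algebraic w0_pos w0_int e_ge0 j_unb.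
exists w; split=> // -[/tau0_interior_weight //|].
exact: boundary_not_tau1 C0 CD w_pos wB xi0.
Qed.
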